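(* Let $N\ge 2$, let $\boldsymbol{\mathcal{M}} \in \mathbb{R}^{n\times\cdots\times n}$ be an $N$-mode tensor, let $r_t\ge 1$ be an integer target rank, and let $p\ge 2$ be an integer oversampling parameter such that $\ell := r_t+p<n$. Let $\widehat{\boldsymbol{\mathcal{M}}}=[\boldsymbol{\mathcal{G}};\mathbf{A}_1,\dots,\mathbf{A}_N]$ be the random Tucker approximation of $\boldsymbol{\mathcal{M}}$ output by the Randomized Interpolatory Tensor Decomposition (described in the context) with inputs $\boldsymbol{\mathcal{M}}$, target rank $(r_t,\dots,r_t)$ and oversampling parameter $p$, where the index selection is performed by strong rank-revealing QR with parameter $f=2$. Then the expected approximation error, with respect to the Gaussian random matrices $\mathbf{\Omega}_1,\dots,\mathbf{\Omega}_N$ drawn by the algorithm, satisfies $$\mathbb{E}_{\{\mathbf{\Omega}_k\}_{k=1}^N}\,\|\boldsymbol{\mathcal{M}}-\widehat{\boldsymbol{\mathcal{M}}}\|_F \;\le\; \sum_{j=1}^N \big(g(n,\ell)\big)^j\left(\Big(1+\frac{r_t}{p-1}\Big)\sum_{i=r_t+1}^n \sigma_i^2\big(\mathbf{M}_{(j)}\big)\right)^{1/2},$$ where $g(n,\ell)=\sqrt{1+4\ell(n-\ell)}$, and $\sigma_i(\mathbf{M}_{(j)})$ is the $i$-th largest singular value of the mode-$j$ unfolding $\mathbf{M}_{(j)}$.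
   Context: **Tensor notation.** For an $N$-mode tensor $\boldsymbol{\mathcal{X}}\in\mathbb{R}^{I_1\times\cdots\times I_N}$, the mode-$j$ unfolding $\mathbf{X}_{(j)}\in\mathbb{R}^{I_j\times\prod_{k\ne j}I_k}$ is the matrix whose columns are the mode-$j$ fibers of $\boldsymbol{\mathcal{X}}$ (the vectors obtained by fixing all indices except the $j$-th). For $\mathbf{A}\in\mathbb{R}^{m\times I_j}$, the mode-$j$ product $\boldsymbol{\mathcal{Y}}=\boldsymbol{\mathcal{X}}\times_j\mathbf{A}$ is the tensor with $\boldsymbol{\mathcal{Y}}_{i_1,\dots,i_{j-1},k,i_{j+1},\dots,i_N}=\sum_{i_j=1}^{I_j}x_{i_1,\dots,i_N}a_{k i_j}$ for $1\le k\le m$; equivalently $\mathbf{Y}_{(j)}=\mathbf{A}\mathbf{X}_{(j)}$. The Tucker notation $[\boldsymbol{\mathcal{G}};\mathbf{A}_1,\dots,\mathbf{A}_N]$ denotes the tensor $\boldsymbol{\mathcal{G}}\times_1\mathbf{A}_1\times_2\cdots\times_N\mathbf{A}_N$. $\|\cdot\|_F$ is the Frobenius norm (square root of the sum of squares of all entries). For index sets $\mathcal{J}_1,\dots,\mathcal{J}_N\subset\{1,\dots,n\}$, $\boldsymbol{\mathcal{M}}(\mathcal{J}_1,\dots,\mathcal{J}_N)$ is the subtensor with mode-$j$ indices restricted to $\mathcal{J}_j$; for a matrix $\mathbf{Q}$, $\mathbf{Q}(\mathcal{J},:)$ is the submatrix of the rows indexed by $\mathcal{J}$ (index sets are ordered,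 with the same ordering used throughout). **Randomized Interpolatory Tensor Decomposition.** Input: $\boldsymbol{\mathcal{M}}\in\mathbb{R}^{n\times\cdots\times n}$ of order $N$, target rank $(r_t,\dots,r_t)$, oversampling $p$; set $\ell=r_t+p$. For each mode $j=1,\dots,N$: 1. Draw a standard Gaussian random matrix $\mathbf{\Omega}_j\in\mathbb{R}^{n^{N-1}\times\ell}$ (i.i.d. $N(0,1)$ entries), independently across modes. 2. Form $\mathbf{Y}_j=\mathbf{M}_{(j)}\mathbf{\Omega}_j\in\mathbb{R}^{n\times\ell}$. 3. Compute a thin QR factorization $\mathbf{Y}_j=\mathbf{Q}_j\mathbf{R}_j$, where $\mathbf{Q}_j\in\mathbb{R}^{n\times\ell}$ has orthonormal columns. 4. Apply strong rank-revealing QR with parameter $f=2$ to $\mathbf{Q}_j^\top\in\mathbb{R}^{\ell\times n}$, obtaining a permutation matrix $[\mathbf{P}_1\ \mathbf{P}_2]$ with $\mathbf{P}_1\in\mathbb{R}^{n\times\ell}$ and a factorization $\mathbf{Q}_j^\top[\mathbf{P}_1\ \mathbf{P}_2]=\mathbf{Z}[\mathbf{R}_{11}\ \mathbf{R}_{12}]$. Let $\mathcal{J}_j$, with $|\mathcal{J}_j|=\ell$, be the set of indices corresponding to the columns of $\mathbf{P}_1$. 5. Set $\mathbf{A}_j=\mathbf{Q}_j\big(\mathbf{Q}_j(\mathcal{J}_j,:)\big)^{-1}\in\mathbb{R}^{n\times\ell}$. Finally set $\boldsymbol{\mathcal{G}}=\boldsymbol{\mathcal{M}}(\mathcal{J}_1,\dots,\mathcal{J}_N)\in\mathbb{R}^{\ell\times\cdots\times\ell}$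 and output $\widehat{\boldsymbol{\mathcal{M}}}=[\boldsymbol{\mathcal{G}};\mathbf{A}_1,\dots,\mathbf{A}_N]$. **Strong rank-revealing QR (Gu–Eisenstat) with parameter $f$.** For a matrix $\mathbf{Q}^\top\in\mathbb{R}^{\ell\times n}$ of full row rank $\ell$, this procedure returns a permutation $[\mathbf{P}_1\ \mathbf{P}_2]$ and a factorization $\mathbf{Q}^\top[\mathbf{P}_1\ \mathbf{P}_2]=\mathbf{Z}[\mathbf{R}_{11}\ \mathbf{R}_{12}]$ with $\mathbf{Z}\in\mathbb{R}^{\ell\times\ell}$ orthogonal, $\mathbf{R}_{11}\in\mathbb{R}^{\ell\times\ell}$ upper triangular and invertible, and every entry of $\mathbf{R}_{11}^{-1}\mathbf{R}_{12}$ bounded by $f$ in absolute value. The choices in the QR steps are understood to be made by a fixed (measurable) deterministic rule, so that $\widehat{\boldsymbol{\mathcal{M}}}$ is a random variable that is a function of $\mathbf{\Omega}_1,\dots,\mathbf{\Omega}_N$. *)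

(* Defs.v *)
From HB Require Import structures.
From mathcomp Require Import all_boot all_order all_fingroup all_algebra.
From mathcomp Require Import polyrcf.
From mathcomp Require Import all_classical all_reals all_analysis.

Set Implicit Arguments.
Unset Strict Implicit.
Unset Printing Implicit Defensive.

Import Order.TTheory GRing.Theory Num.Theory.
Import numFieldNormedType.Exports.

Local Open Scope classical_set_scope.
Local Open Scope ring_scope.

(* Modes are numbered from 0: mode [j : 'I_N] is the usual mode j + 1, and
   tensor indices likewise range over {0, ..., n - 1}. *)
Definition tensor (R : Type) (N n : nat) := {ffun {ffun 'I_N -> 'I_n} -> R}.

Definition frobenius (R : realType) (N n : nat) (X : tensor R N n) : R :=
  Num.sqrt (\sum_i X i ^+ 2).

(* The multi-index whose j-th entry is [a] and whose other entries are those
   of [c], in order. *)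
Definition fiber_index (N n : nat) (j : 'I_N) (a : 'I_n)
    (c : {ffun 'I_N.-1 -> 'I_n}) : {ffun 'I_N -> 'I_n} :=
  [ffun k => if unlift j k is Some k' then c k' else a].

Lemma card_fibers (N n : nat) : #|{ffun 'I_N.-1 -> 'I_n}| = (n ^ N.-1)%N.
Proof. by rewrite card_ffun !card_ord. Qed.

(* The order of the columns is that of the enumeration of the indices of the
   remaining modes. *)
Definition unfold (R : realType) (N n : nat) (j : 'I_N) (X : tensor R N n) :
    'M[R]_(n, n ^ N.-1) :=
  \matrix_(a, c)
    X (fiber_index j a (enum_val (cast_ord (esym (card_fibers N n)) c))).

(* [G; A_0, ..., A_(N-1)]: the (a_0, ..., a_(N-1)) entry of the successive mode
   products G x_0 A_0 x_1 ... x_(N-1) A_(N-1) is the sum over i of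
   G_(i_0, ..., i_(N-1)) (A_0)_(a_0, i_0) ... (A_(N-1))_(a_(N-1), i_(N-1)). *)
Definition tucker (R : realType) (N n l : nat) (G : tensor R N l)
    (A : 'I_N -> 'M[R]_(n, l)) : tensor R N n :=
  [ffun a : {ffun 'I_N -> 'I_n} =>
     \sum_(i : {ffun 'I_N -> 'I_l}) G i * \prod_(k < N) A k (a k) (i k)].

(* An ordered index set of size l is given by its enumeration 'I_l -> 'I_n. *)
Definition subtensor (R : realType) (N n l : nat) (X : tensor R N n)
    (J : 'I_N -> 'I_l -> 'I_n) : tensor R N l :=
  [ffun i : {ffun 'I_N -> 'I_l} => X [ffun k => J k (i k)]].

(* The eigenvalues of A A^T with multiplicity, in nondecreasing order
   ([rootsR] lists the distinct real roots in increasing order). *)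
Definition gram_spectrum (R : realType) (m q : nat) (A : 'M[R]_(m, q)) :
    seq R :=
  let chi := char_poly (A *m A^T) in
  flatten [seq nseq (mup x chi) x | x <- rootsR chi].

(* Numbered from 0: [singular_value A i] is the (i + 1)-st largest singular
   value of A, i.e., the square root of the (i + 1)-st largest eigenvalue of
   A A^T counted with multiplicity. *)
Definition singular_value (R : realType) (m q : nat) (A : 'M[R]_(m, q))
    (i : nat) : R :=
  Num.sqrt (nth 0 (rev (gram_spectrum A)) i).

Definition orthonormal_cols (R : realType) (m q : nat) (Q : 'M[R]_(m, q)) :=
  Q^T *m Q = 1%:M.

(* [is_trig_mx] means lower triangular. *)
Definition upper_triangular (R : realType) (m q : nat) (A : 'M[R]_(m, q)) :=
  is_trig_mx A^T.

Definition thin_QR (R : realType) (n l : nat) (Y Q : 'M[R]_(n, l))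
    (S : 'M[R]_l) :=
  [/\ Y = Q *m S, orthonormal_cols Q & upper_triangular S].

(* Column k of [col_perm s B] is column [s k] of B, so that
   [col_perm s B] = B [P1 P2] for the permutation matrix [P1 P2] of s^-1, and
   the columns kept in B P1 are those of index s 0, ..., s (l - 1). *)
Definition strong_RRQR (R : realType) (f : R) (n l : nat) (le_ln : (l <= n)%N)
    (B : 'M[R]_(l, n)) (s : 'S_n)
    (Z R11 : 'M[R]_l) (R12 : 'M[R]_(l, n - l)) :=
  [/\ col_perm s B =
        Z *m castmx (erefl l, subnKC le_ln) (row_mx R11 R12),
      orthonormal_cols Z,
      upper_triangular R11,
      R11 \in unitmx
    & forall i j, `|(invmx R11 *m R12) i j| <= f].

(* The sigma-algebra on matrices generated by the entries, i.e., the Borel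
   sigma-algebra of R^(m x q). *)
Definition mx_measurable (R : realType) (m q : nat) :
    set (set 'M[R]_(m, q)) :=
  <<s [set E : set 'M[R]_(m, q) | exists (i : 'I_m) (j : 'I_q) (U : set R),
         measurable U /\ E = [set A | U (A i j)]] >>.

(* A measurable rule choosing the orthonormal factor of a thin QR
   factorization. *)
Definition QR_rule (R : realType) (n l : nat)
    (qr : 'M[R]_(n, l) -> 'M[R]_(n, l)) :=
  (forall Y, exists S, thin_QR Y (qr Y) S) /\
  (forall E : set 'M[R]_(n, l), mx_measurable E -> mx_measurable (qr @^-1` E)).

(* A measurable rule choosing the permutation of a strong rank-revealing QR
   factorization, for matrices of full row rank. *)
Definition RRQR_rule (R : realType) (f : R) (n l : nat) (le_ln : (l <= n)%N)
    (rrqr : 'M[R]_(l, n) -> 'S_n) :=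
  (forall B, row_free B ->
     exists Z R11 R12, strong_RRQR f le_ln B (rrqr B) Z R11 R12) /\
  (forall s : 'S_n, mx_measurable [set B | rrqr B = s]).

Section Randomized_interpolatory_decomposition.
Variables (R : realType) (N n l : nat) (le_ln : (l <= n)%N).
Variables (qr : 'I_N -> 'M[R]_(n, l) -> 'M[R]_(n, l)).
Variables (rrqr : 'I_N -> 'M[R]_(l, n) -> 'S_n).
Variables (M : tensor R N n) (Omega : 'I_N -> 'M[R]_(n ^ N.-1, l)).

Definition rid_Q (j : 'I_N) : 'M[R]_(n, l) :=
  qr j (unfold j M *m Omega j).

Definition rid_index (j : 'I_N) (k : 'I_l) : 'I_n :=
  rrqr j (rid_Q j)^T (widen_ord le_ln k).

Definition rid_factor (j : 'I_N) : 'M[R]_(n, l) :=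
  rid_Q j *m invmx (rowsub (rid_index j) (rid_Q j)).

Definition rid : tensor R N n := tucker (subtensor M rid_index) rid_factor.

End Randomized_interpolatory_decomposition.

Local Open Scope ereal_scope.

(* Mutual independence of a finite family of real random variables. *)
Definition mutually_independent d (T : measurableType d) (R : realType)
    (P : probability T R) (I : finType) (X : I -> {RV P >-> R}) :=
  forall (K : {set I}) (U : I -> set R),
    (forall i, measurable (U i)) ->
    P [set t | forall i, i \in K -> U i (X i t)] =
    \prod_(i in K) P (X i @^-1` U i).

Definition iid_standard_normal d (T : measurableType d) (R : realType)
    (P : probability T R) (I : finType) (X : I -> {RV P >-> R}) :=
  mutually_independent X /\
  forall i (U : set R), measurable U ->
    distribution P (X i) U = normal_prob 0 1 U.

Local Close Scope ereal_scope.

(* The random matrices Omega_j whose entries are the random variables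
   W (j, c, k). *)
Definition random_matrices d (T : measurableType d) (R : realType)
    (P : probability T R) (N q l : nat)
    (W : 'I_N * 'I_q * 'I_l -> {RV P >-> R}) (t : T) (j : 'I_N) :
    'M[R]_(q, l) :=
  \matrix_(c, k) W (j, c, k) t.

Definition rid_growth (R : realType) (n l : nat) : R :=
  Num.sqrt (1 + 4 * l%:R * (n%:R - l%:R)).

(* Main.v *)
Require Import Defs.
From HB Require Import structures.
From mathcomp Require Import all_boot all_order all_fingroup all_algebra.
From mathcomp Require Import all_classical all_reals all_analysis.
From mathcomp Require Import spectral complex polyrcf.
From mathcomp Require Import measurable_realfun.
From mathcomp Require Import ring lra.

(**
The error is split over the modes, one term for each replacement of the
identity by the interpolatory projector [Pi_j], the product of the factor
[A_j] and the selection of the rows of index in [J_j] ([tucker_telescope]).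
When the selected rows come first, [A_j] is an identity block above a block
[W] whose entries are at most 2 in absolute value; hence [Pi_j] and [1 - Pi_j]
both have a squared spectral norm at most [g ^ 2 = 1 + 4 l (n - l)]
([interp_proj_opnorm], [interp_compl_opnorm]). As [1 - Pi_j] also kills the
range of the sketch [A Om] of the unfolding [A] ([interp_compl_Q]), the term of
mode [j] is at most [g ^ j.+1 * |A - A Om X|] for every matrix [X]
([rid_error_le]).

The rest concerns a single Gaussian sketch. Let [Pi] be the projector onto the
span of [rt] leading right singular vectors of [A] ([leading_projector]), and
let [X] be the ridge regularization, with parameter [eps], of the pseudo-inverse
of [Pi Om]. The residual splits orthogonally into [C = A (1 - Pi)], whose
squared norm is at most the tail of the squared singular values, and a part
whose rows lie in the range of [Pi]: a bias of order [eps] and the matrix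
[C Om X] ([range_error_split]).
Its second moment follows from Stein's identity, applied to two functions of
[Om] ([stein_matrix]). With [G = Pi Om], [S = (G G^T + eps)^-1] and [K = S G]:
- for [K], it gives [(l - rt - 1) E tr(S Pi) <= rt] ([expected_tr_resolvent]),
  the trace bound for inverse Wishart matrices in a form uniform in [eps];
- for [C^T C Om K^T K], it gives [E |C Om K^T|^2 = |C|^2 E |K|^2]
  ([expected_residual]), where [|K|^2 <= tr(S Pi)] and [X = K^T].
The regularization makes [K] smooth with at most polynomial growth, so that
these identities hold without discussing the rank of [G].

Finally [sqrt q <= (q / s + s) / 2], with [s ^ 2] the bound on the expectation
of [q], plays the part of Jensen's inequality, and [eps] tends to 0. The error
is thus bounded pointwise by an integrable function, and the integral of
nonnegative functions is monotone without measurability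
([ge0_le_integral_nonmeasurable]).
*)

Set Implicit Arguments.
Unset Strict Implicit.
Unset Printing Implicit Defensive.

Import Order.TTheory GRing.Theory Num.Theory.
Import numFieldNormedType.Exports.

Local Open Scope classical_set_scope.
Local Open Scope ring_scope.

(** * Gaussian integration by parts on the line *)

Section Normal.
Context {R : realType}.
Notation mu := (@lebesgue_measure R).
Notation gauss := (normal_prob (0 : R) 1).
Notation pdf := (normal_pdf (0 : R) 1).

Lemma ae_eq_normal_pdf :
  ae_eq mu setT (Radon_Nikodym_SigmaFinite.f gauss mu) (EFin \o pdf).
Proof.
have dom := normal_prob_dominates (0 : R) 1.
apply: integral_ae_eq => //.
- exact: Radon_Nikodym_SigmaFinite.f_integrable.
- by apply/measurable_EFinP; exact: measurable_normal_pdf.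
- by move=> E _ mE; rewrite -Radon_Nikodym_SigmaFinite.f_integral.
Qed.

Lemma ge0_integral_normal_prob (f : R -> \bar R) :
  (forall x, 0 <= f x)%E -> measurable_fun setT f ->
  (\int[gauss]_x f x = \int[mu]_x (f x * (pdf x)%:E))%E.
Proof.
move=> f0 mf; have dom := normal_prob_dominates (0 : R) 1.
rewrite -(Radon_Nikodym_SigmaFinite.change_of_variables dom)//.
apply: ge0_ae_eq_integral => //.
- apply: emeasurable_funM => //.
  exact: measurable_int (Radon_Nikodym_SigmaFinite.f_integrable _).
- apply: emeasurable_funM => //.
  by apply/measurable_EFinP; exact: measurable_normal_pdf.
- by move=> x _; rewrite mule_ge0// Radon_Nikodym_SigmaFinite.f_ge0.
- by move=> x _; rewrite mule_ge0// lee_fin normal_pdf_ge0.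
- exact/ae_eqe_mul2l/ae_eq_normal_pdf.
Qed.

Lemma integrable_normal_probP (f : R -> R) : measurable_fun setT f ->
  gauss.-integrable setT (EFin \o f) <->
  mu.-integrable setT (fun x => (f x * pdf x)%:E).
Proof.
move=> mf.
have mp : measurable_fun setT (fun x : R => f x * pdf x).
  by apply: measurable_funM => //; exact: measurable_normal_pdf.
have E : (\int[gauss]_x `|(f x)%:E| = \int[mu]_x `|(f x * pdf x)%:E|)%E.
  rewrite ge0_integral_normal_prob//; last first.
    by apply: measurableT_comp => //; exact/measurable_EFinP.
  apply: eq_integral => x _; rewrite EFinM abseM; congr (_ * _)%E.
  by rewrite /= ger0_norm// normal_pdf_ge0.
split=> /integrableP[_ fi]; apply/integrableP; split.
- exact/measurable_EFinP.
- by rewrite -E.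
- exact/measurable_EFinP.
- by rewrite [ltLHS]E.
Qed.

Lemma integral_normal_prob (f : R -> R) :
  gauss.-integrable setT (EFin \o f) ->
  (\int[gauss]_x (f x)%:E = \int[mu]_x (f x * pdf x)%:E)%E.
Proof.
move=> fi; have mf : measurable_fun setT f.
  by apply/measurable_EFinP; exact: measurable_int fi.
rewrite integralE [RHS]integralE !ge0_integral_normal_prob//.
- congr (_ - _)%E; apply: eq_integral => x _.
  + have := congr1 (@^~ x) (ge0_funeposM (EFin \o f) (normal_pdf_ge0 0 1 x)).
    rewrite /= muleC => <-; rewrite !funeposE; congr maxe; exact: muleC.
  + have := congr1 (@^~ x) (ge0_funenegM (EFin \o f) (normal_pdf_ge0 0 1 x)).
    rewrite /= muleC => <-; rewrite !funenegE; congr (maxe (- _)%E _); exact: muleC.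
- by apply: measurable_funeneg; exact/measurable_EFinP.
- by apply: measurable_funepos; exact/measurable_EFinP.
Qed.

Lemma poly_le_expR_sqr (d : nat) (x : R) :
  (1 + `|x|) ^+ d <= (4 * d.+1%:R) ^+ d * expR (x ^+ 2 / 4).
Proof.
have d0 : 0 < (d.+1%:R : R) by rewrite ltr0n.
have h : 1 + `|x| <= 4 * d.+1%:R * expR (x ^+ 2 / 4 / d.+1%:R).
  apply: le_trans (ler_wpM2l _ (expR_ge1Dx _)); last by rewrite mulr_ge0 ?ler0n.
  rewrite mulrDr mulr1.
  have -> : 4 * d.+1%:R * (x ^+ 2 / 4 / d.+1%:R) = x ^+ 2.
    by move: d0; move: (d.+1%:R : R) => u u0; field; rewrite gt_eqF.
  have : (1 : R) <= d.+1%:R by rewrite ler1n.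
  have := sqr_ge0 x; have := sqr_ge0 (`|x| - 1).
  rewrite sqrrB expr1n mulr1 real_normK ?num_real//.
  set y := `|x|; set z := x ^+ 2; set u := d.+1%:R; lra.
apply: le_trans (lerXn2r _ _ _ h) _.
- by rewrite nnegrE addr_ge0.
- by rewrite nnegrE (le_trans _ h)// addr_ge0.
rewrite exprMn -expRM_natl ler_pM2l ?exprn_gt0 ?mulr_gt0// ler_expR.
rewrite -mulr_natl mulrCA ler_piMr ?divr_ge0 ?sqr_ge0//.
by rewrite ler_pdivrMr// mul1r mulr1 ler_nat.
Qed.

(** Half of the exponent of the Gaussian density absorbs the polynomial; the
    other half is the exponent of a density of variance 2. *)
Lemma poly_normal_pdf_le (d : nat) : exists2 c : R, 0 <= c &
  forall x : R, (1 + `|x|) ^+ d * pdf x <= c * normal_pdf 0 (Num.sqrt 2) x.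
Proof.
have s2 : Num.sqrt 2 != 0 :> R by rewrite gt_eqF// sqrtr_gt0.
pose q := normal_peak (Num.sqrt 2) : R.
have q0 : 0 < q by exact: normal_peak_gt0.
exists ((4 * d.+1%:R) ^+ d * normal_peak 1 / q).
  apply: divr_ge0; last exact: ltW.
  by rewrite mulr_ge0 ?normal_peak_ge0// exprn_ge0// mulr_ge0.
move=> x; rewrite !normal_pdfE ?oner_neq0// -/q [leRHS]mulrA divfK ?gt_eqF//.
rewrite /normal_fun !subr0 expr1n sqr_sqrtr//.
have -> : expR (- x ^+ 2 / (2 *+ 2)) =
          expR (x ^+ 2 / 4) * expR (- x ^+ 2 / (1 *+ 2)) :> R.
  by rewrite -expRD; congr expR; field.
rewrite [leLHS]mulrA [leRHS]mulrA ler_pM2r ?expR_gt0//.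
rewrite [leLHS]mulrC -[leRHS]mulrA [leRHS]mulrC -[leRHS]mulrA ler_wpM2l//.
  by rewrite normal_peak_ge0.
by rewrite mulrC poly_le_expR_sqr.
Qed.

Lemma integrable_poly_normal_pdf (f : R -> R) (c : R) (d : nat) :
  measurable_fun setT f -> (forall x, `|f x| <= c * (1 + `|x|) ^+ d) ->
  mu.-integrable setT (fun x => (f x * pdf x)%:E).
Proof.
move=> mf fc; have [K K0 HK] := poly_normal_pdf_le d.
apply: (@le_integrable _ _ _ mu _ measurableT _
   (fun x => ((c * K) * normal_pdf 0 (Num.sqrt 2) x)%:E)) => //.
- by apply/measurable_EFinP/measurable_funM => //; exact: measurable_normal_pdf.
- move=> x _; rewrite /= lee_fin.
  rewrite normrM (ger0_norm (normal_pdf_ge0 _ _ _)).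
  apply: le_trans (ler_wpM2r (normal_pdf_ge0 _ _ _) (fc x)) _.
  have c0 : 0 <= c.
    by have := le_trans (normr_ge0 _) (fc 0); rewrite normr0 addr0 expr1n mulr1.
  rewrite -[leLHS]mulrA; apply: le_trans (ler_wpM2l c0 (HK x)) _.
  by rewrite mulrA ler_norm.
- under eq_fun do rewrite EFinM.
  by apply: integrableZl => //; exact: integrable_normal_pdf.
Qed.

Lemma integrable_poly_normal_prob (f : R -> R) (c : R) (d : nat) :
  measurable_fun setT f -> (forall x, `|f x| <= c * (1 + `|x|) ^+ d) ->
  gauss.-integrable setT (EFin \o f).
Proof.
by move=> mf fc; apply/integrable_normal_probP => //; exact: integrable_poly_normal_pdf fc.
Qed.

Lemma is_derive_normal_pdf (x : R) : is_derive x 1 pdf (- x * pdf x).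
Proof.
rewrite normal_pdfE ?oner_neq0//.
have -> : (fun x : R => normal_peak 1 * normal_fun 0 1 x) =
  (fun x : R => normal_peak 1 * (expR \o (fun x => - (x * x) / 2)) x).
  by apply/funext => y; rewrite /normal_fun /= subr0 expr1n.
have D : is_derive x 1 (fun x : R => - (x * x) / 2) (- x).
  apply: is_derive_eq.
  rewrite !scaler0 add0r !scaler1 /GRing.scale /=; lra.
have D2 := is_derive1_comp (is_derive_expR _) D.
apply: (is_derive_eq (is_deriveZ (normal_peak 1 : R) D2)).
rewrite /GRing.scale /= /normal_fun subr0 expr1n -expr2; ring.
Qed.

(** The total integral of the derivative of [f * pdf] vanishes, as this function
    tends to 0 at infinity. *)
Lemma gauss_by_parts (f f' : R -> R) (c : R) (d : nat) :
  (forall x : R, is_derive x 1 f (f' x)) -> continuous f' ->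
  (forall x, `|f x| <= c * (1 + `|x|) ^+ d) ->
  (forall x, `|f' x| <= c * (1 + `|x|) ^+ d) ->
  (\int[gauss]_x ((x : R) * f x)%:E = \int[gauss]_x (f' x)%:E)%E.
Proof.
move=> df cf' fc f'c.
have c0 : 0 <= c.
  by have := le_trans (normr_ge0 _) (fc 0); rewrite normr0 addr0 expr1n mulr1.
have cf : continuous f.
  by move=> x; apply: differentiable_continuous; apply/derivable1_diffP; have [] := df x.
have cp : continuous pdf by apply: continuous_normal_pdf; exact: oner_neq0.
have mf := continuous_measurable_fun cf.
have mf' := continuous_measurable_fun cf'.
have mxf : measurable_fun setT (fun x : R => x * f x) by exact: measurable_funM.
have xfc x : `|x * f x| <= c * (1 + `|x|) ^+ d.+1.
  rewrite normrM exprS mulrCA ler_pM// lerDr.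
  by rewrite ler01.
rewrite (integral_normal_prob (integrable_poly_normal_prob mxf xfc)).
rewrite (integral_normal_prob (integrable_poly_normal_prob mf' f'c)).
pose H x := f x * pdf x; pose h x := f' x * pdf x - x * f x * pdf x.
have dH (x : R) : is_derive x 1 H (h x).
  have := is_deriveM (df x) (is_derive_normal_pdf x).
  by move/is_derive_eq; apply; rewrite /GRing.scale /= /h; ring.
have ch : continuous h.
  move=> x; apply: cvgB; apply: cvgM => //; [exact: cf'|exact: cp| |exact: cp].
  by apply: cvgM => //; exact: cf.
have i1 := integrable_poly_normal_pdf mf' f'c.
have i2 := integrable_poly_normal_pdf mxf xfc.
have hE : (fun x => (h x)%:E) = (fun x => (f' x * pdf x)%:E - (x * f x * pdf x)%:E)%E.
  by apply/funext => x; rewrite -EFinB.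
have ih : mu.-integrable setT (EFin \o h).
  by rewrite [X in _.-integrable _ X]hE; exact: integrableB.
suff h0 : (\int[mu]_x (h x)%:E = 0)%E.
  have fa := integrable_fin_num measurableT i2.
  rewrite -[RHS](subeK _ fa) -integralB//.
  by rewrite -[X in (X + _)%E](_ : \int[mu]_x (h x)%:E = _)%E ?h0 ?add0e// hE.
(* One factor [1 + `|x|] more than the growth of [f] turns boundedness into decay. *)
have [K K0 HK] := poly_normal_pdf_le d.+1.
pose q := normal_peak (Num.sqrt 2) : R.
have s2 : Num.sqrt 2 != 0 :> R by rewrite gt_eqF// sqrtr_gt0.
have HB x : `|H x| <= c * K * q / (1 + `|x|).
  have x1 : 0 < 1 + `|x| by rewrite ltr_wpDr.
  rewrite ler_pdivlMr// normrM (ger0_norm (normal_pdf_ge0 _ _ _)).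
  have := ler_wpM2r (normal_pdf_ge0 0 1 x) (fc x).
  move=> /(fun h => ler_wpM2r (ltW x1) h) /le_trans; apply.
  rewrite -!mulrA ler_wpM2l// [_ * (1 + _)]mulrC mulrA -exprSr.
  by rewrite (le_trans (HK x))// ler_wpM2l// normal_pdf_ub.
pose I n : set R := `[- n.+1%:R, n.+1%:R]%classic.
have FTC n : (\int[mu]_(x in I n) (h x)%:E = (H n.+1%:R - H (- n.+1%:R))%:E)%E.
  rewrite EFinB; apply: continuous_FTC2.
  - by rewrite -subr_gt0 opprK addr_gt0.
  - exact: continuous_subspaceT.
  - have cH : continuous H.
      by move=> x; apply: differentiable_continuous; apply/derivable1_diffP; have [] := dH x.
    split; first by move=> x _; have [] := dH x.
    + exact/cvg_at_right_filter/cH.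
    + exact/cvg_at_left_filter/cH.
  - by move=> x _; rewrite derive1E; have [] := dH x.
have L1 : (fun n => \int[mu]_(x in I n) (h x)%:E)%E @ \oo --> (\int[mu]_x (h x)%:E)%E.
  under eq_fun do rewrite integral_mkcond.
  have [||| | | _ _] // := @dominated_convergence _ _ _ mu setT measurableT
      (fun n => ((EFin \o h) \_ (I n)))%E (EFin \o h) (fun x => `|(h x)%:E|)%E.
  - move=> n; apply: (measurable_restrictT _ _).1; first exact: measurable_itv.
    by apply: measurable_funS (measurable_int _ ih).
  - exact: measurable_int ih.
  - apply: aeW => x _; apply: cvg_near_cst.
    near=> n. rewrite patchE mem_set// /I /= in_itv /= -ler_norml.
    apply: (@le_trans _ _ n%:R); last by rewrite ler_nat.
    near: n; exact: nbhs_infty_ger.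
  - exact: integrable_abse.
  - apply: aeW => x n _; rewrite patchE; case: ifPn => //= _.
    by rewrite normr0 lee_fin.
have L2 : (fun n => \int[mu]_(x in I n) (h x)%:E)%E @ \oo --> 0%E.
  under eq_fun do rewrite FTC.
  apply: cvg_EFin; first exact: nearW.
  apply/cvgr0Pnorm_le => e e0.
  have B0 : 0 <= c * K * q by rewrite !mulr_ge0// normal_peak_ge0.
  near=> n.
  have Hn : `|H n.+1%:R - H (- n.+1%:R)| <= 2 * (c * K * q / (1 + n.+1%:R)).
    apply: le_trans (ler_normB _ _) _.
    have := HB n.+1%:R; have := HB (- n.+1%:R).
    by rewrite normrN (@ger0_norm _ n.+1%:R)//; lra.
  apply: le_trans Hn _; rewrite mulrA ler_pdivrMr// mulrC -ler_pdivrMl//.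
  apply: (@le_trans _ _ n%:R); last by rewrite -natr1; lra.
  near: n; exact: nbhs_infty_ger.
exact: (cvg_unique _ L1 L2).
Unshelve. all: by end_near.
Qed.
End Normal.

(** * Resampling one coordinate of a Gaussian family *)

Section Resampling.
Context {R : realType} {I : finType}.

Definition rectangle (U : I -> set R) : set (I -> R) :=
  [set w | forall i, U i (w i)].

Definition rectangles : set (set (I -> R)) :=
  [set E | exists2 U : I -> set R,
     (forall i, measurable (U i)) & E = rectangle U].

(** The sigma-algebra is generated by rectangles, which are closed under
    intersection: a law on this space is determined by its values on them. *)
Definition coord_space := g_sigma_algebraType rectangles.

HB.instance Definition _ := Measurable.on coord_space.

Definition update (w : I -> R) (i : I) (x : R) : I -> R :=
  fun j => if j == i then x else w j.

Lemma setI_closed_rectangles : setI_closed rectangles.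
Proof.
move=> _ _ [U mU ->] [V mV ->]; exists (fun i => U i `&` V i).
  by move=> i; exact: measurableI.
by apply/seteqP; split=> [w [] hU hV i|w h]; [|split=> i; have [] := h i].
Qed.

Lemma measurable_coord (i : I) :
  measurable_fun setT (fun w : coord_space => w i).
Proof.
move=> _ U mU; rewrite setTI; apply: sub_sigma_algebra.
exists (fun j => if j == i then U else setT).
  by move=> j; case: ifP.
apply/seteqP; split=> [w Uw j|w]; first by have [->|//] := eqVneq j i.
by move=> /(_ i); rewrite eqxx.
Qed.

Lemma measurable_to_coord d (T : measurableType d) (g : T -> coord_space) :
  (forall i, measurable_fun setT (fun t => g t i)) -> measurable_fun setT g.
Proof.
move=> mg; apply: (@measurability _ _ T coord_space setT g rectangles) => //.
move=> _ [_ [U mU ->] <-]; rewrite setTI.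
have -> : g @^-1` rectangle U = \bigcap_(i in [set: I]) ((fun t => g t i) @^-1` U i).
  by apply/seteqP; split=> [t h i _|t h i]; [exact: h|exact: (h i)].
apply: fin_bigcap_measurable => // i _.
by rewrite -[X in measurable X]setTI; exact: mg.
Qed.

Lemma measurable_update (i : I) :
  measurable_fun setT
    (fun z : coord_space * measurableTypeR R => update z.1 i z.2 : coord_space).
Proof.
apply: measurable_to_coord => j; rewrite /update; case: (j == i).
  exact: measurable_snd.
by apply: (measurableT_comp (measurable_coord j)); exact: measurable_fst.
Qed.

End Resampling.
Arguments coord_space : clear implicits.
Arguments rectangles : clear implicits.

Section Resample.
Context {R : realType} {I : finType} d (T : measurableType d).
Variables (P : probability T R) (X : I -> {RV P >-> R}).
Hypothesis X_iid : iid_standard_normal X.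
Notation S := (coord_space R I).
Notation gauss := (normal_prob (0 : R) 1).

Definition joint (t : T) : S := fun i => X i t.

Lemma measurable_joint : measurable_fun setT joint.
Proof. by apply: measurable_to_coord => i; exact: measurable_funPT. Qed.

Definition resample (i : I) (z : T * measurableTypeR R) : S := update (joint z.1) i z.2.

Lemma measurable_resample i : measurable_fun setT (resample i).
Proof.
apply: (measurableT_comp (measurable_update i)
   (_ : measurable_fun setT (fun z : T * measurableTypeR R => (joint z.1, z.2)))).
apply/measurable_fun_pair => /=; last exact: measurable_snd.
exact: (measurableT_comp measurable_joint measurable_fst).
Qed.

Definition jointM : {mfun T >-> S} := HB.pack joint
  (isMeasurableFun.Build _ _ _ _ joint measurable_joint).
Definition resampleM i : {mfun (T * measurableTypeR R)%type >-> S} := HB.pack (resample i)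
  (isMeasurableFun.Build _ _ _ _ (resample i) (measurable_resample i)).

(** Both laws give a rectangle the product of the normal probabilities of its
    sides, and rectangles determine a law. *)
Lemma resample_law (i : I) (A : set S) : measurable A ->
  P (joint @^-1` A) = (P \x gauss)%E (resample i @^-1` A).
Proof.
have [ind law] := X_iid.
move=> mA; apply: (@g_sigma_algebra_measure_unique _ _ S (rectangles R I) _ (fun=> setT)
   _ _ (pushforward P jointM) (pushforward (P \x gauss)%E (resampleM i))) mA.
- by move=> E hE; apply: sub_sigma_algebra.
- by move=> _; exists (fun=> setT) => //; apply/seteqP; split.
- by rewrite bigcup_const.
- exact: setI_closed_rectangles.
- move=> _ [U mU ->].
  change (P (joint @^-1` rectangle U) = (P \x gauss)%E (resample i @^-1` rectangle U)).
  have -> : joint @^-1` rectangle U = [set t | forall j, j \in [set: I]%SET -> U j (X j t)].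
    by apply/seteqP; split=> [t h j _|t h j]; apply: h; rewrite ?inE.
  have -> : resample i @^-1` rectangle U =
     [set t | forall j, j \in (~: [set i])%SET -> U j (X j t)] `*` U i.
    apply/seteqP; split=> [[t x] h|[t x] [/= h1 h2] j].
      split=> /= [j|].
        by rewrite !inE => /negPf ji; have := h j; rewrite /resample /update ji.
      by have := h i; rewrite /resample /update eqxx.
    rewrite /resample /update; case: ifPn => [/eqP -> //|ji]; apply: h1; by rewrite !inE.
  have mI : measurable [set t | forall j, j \in (~: [set i])%SET -> U j (X j t)].
    have -> : [set t | forall j, j \in (~: [set i])%SET -> U j (X j t)] =
       \bigcap_(j in [set j | j \in (~: [set i])%SET]) (X j @^-1` U j).
      by apply/seteqP; split=> t h j; exact: h.
    apply: fin_bigcap_measurable; first exact: finite_finset.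
    by move=> j _; rewrite -[X in measurable X]setTI; exact: measurable_funP.
  rewrite product_measure1E//.
  rewrite !(ind _ U mU) (bigD1 i)//= muleC; congr (_ * _)%E; last exact: (law i).
  by rewrite ind//; apply: eq_bigl => j; rewrite !inE.
  exact: mU.
- by move=> *; exact: (le_lt_trans (probability_le1 P measurableT) (ltry 1)).
Qed.

(** The integral over one coordinate comes first, the others being fixed: by
    independence, this is Fubini's theorem for the resampled family. *)
Lemma integral_resample (i : I) (f : (I -> R) -> R) :
  measurable_fun (setT : set S) f ->
  P.-integrable setT (fun t => (f (joint t))%:E) ->
  (\int[P]_t (f (joint t))%:E =
   \int[P]_t \int[gauss]_x (f (update (joint t) i x))%:E)%E.
Proof.
move=> mf fi.
have mF : measurable_fun (setT : set S) (EFin \o f) by exact/measurable_EFinP.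
have law := resample_law i.
have ri : (P \x gauss)%E.-integrable setT (fun z => (f (resample i z))%:E).
  apply/integrableP; split.
    by apply: (measurableT_comp mF); exact: measurable_resample.
  have /integrableP[_] := fi; apply: le_lt_trans.
  have h g : (forall y : S, 0 <= g y)%E -> measurable_fun (setT : set S) g ->
      (\int[(P \x gauss)%E]_z g (resample i z) = \int[P]_t g (joint t))%E.
    move=> g0 mg.
    transitivity (\int[pushforward (P \x gauss)%E (resampleM i)]_y g y)%E.
      exact/esym/(ge0_integral_pushforward (measurable_resample i) (P \x gauss)%E
        measurableT mg (fun y _ => g0 y)).
    transitivity (\int[pushforward P jointM]_y g y)%E.
      by apply: eq_measure_integral => A mA _; rewrite -[LHS]law.
    exact: (@ge0_integral_pushforward _ _ _ _ _ _ measurable_joint P setT g measurableT mg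
      (fun y _ => g0 y)).
  by rewrite (h (fun y => `|(f y)%:E|%E))//; apply: measurableT_comp.
rewrite (integral12_prod_meas1 ri).
transitivity (\int[pushforward P jointM]_y (f y)%:E)%E.
  exact/esym/(@integral_pushforward _ _ _ _ _ _ measurable_joint P setT _ mF fi
    measurableT).
transitivity (\int[pushforward (P \x gauss)%E (resampleM i)]_y (f y)%:E)%E; last first.
  exact: (@integral_pushforward _ _ _ _ _ _ (measurable_resample i) (P \x gauss)%E setT
    _ mF ri measurableT).
by apply: eq_measure_integral => A mA _; rewrite -[RHS]law.
Qed.

End Resample.

(** * Stein's identity for tempered functions *)

Section Tempered.
Context {R : realType} {I : finType}.
Notation S := (coord_space R I).
Implicit Types f g : (I -> R) -> R.

(** Being at least 1, it lets bounds of different degrees be added. *)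
Definition weight (w : I -> R) : R := 1 + \sum_i `|w i|.

(** A class stable under sums and products, and integrable because normal
    variables have moments of all orders. *)
Definition tempered f := measurable_fun (setT : set S) f /\
  exists c (d : nat), forall w, `|f w| <= c * weight w ^+ d.

Lemma weight_ge1 w : 1 <= weight w.
Proof. by rewrite lerDl sumr_ge0. Qed.

Lemma tempered_cst (a : R) : tempered (fun=> a).
Proof. by split; [exact: measurable_cst|exists `|a|, 0%N => w; rewrite expr0 mulr1]. Qed.

Lemma tempered_bounded f (a : R) : measurable_fun (setT : set S) f ->
  (forall w, `|f w| <= a) -> tempered f.
Proof. by move=> mf fa; split=> //; exists a, 0%N => w; rewrite expr0 mulr1. Qed.

Lemma tempered_coord (i : I) : tempered (fun w => w i).
Proof.
split; first exact: measurable_coord.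
exists 1, 1%N => w; rewrite mul1r expr1 /weight (bigD1 i)//= addrCA lerDl.
by rewrite addr_ge0// sumr_ge0.
Qed.

Lemma growth_ge0 (c : R) d f : (forall w, `|f w| <= c * weight w ^+ d) -> 0 <= c.
Proof.
move=> /(_ (fun=> 0)); rewrite /weight big1 => [|i _]; last by rewrite normr0.
by rewrite addr0 expr1n mulr1; exact: le_trans.
Qed.

Lemma temperedD f g : tempered f -> tempered g -> tempered (fun w => f w + g w).
Proof.
move=> [mf [c [d fc]]] [mg [b [e gb]]]; split; first exact: measurable_funD.
exists (c + b), (d + e)%N => w; rewrite mulrDl.
apply: le_trans (ler_normD _ _) _; apply: lerD.
  apply: le_trans (fc w) _; rewrite ler_wpM2l ?(growth_ge0 fc)//.
  by rewrite ler_weXn2l ?weight_ge1// leq_addr.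
apply: le_trans (gb w) _; rewrite ler_wpM2l ?(growth_ge0 gb)//.
by rewrite ler_weXn2l ?weight_ge1// leq_addl.
Qed.

Lemma temperedM f g : tempered f -> tempered g -> tempered (fun w => f w * g w).
Proof.
move=> [mf [c [d fc]]] [mg [b [e gb]]]; split; first exact: measurable_funM.
exists (c * b), (d + e)%N => w; rewrite normrM exprD.
apply: le_trans (ler_pM _ _ (fc w) (gb w)) _ => //.
by rewrite -!mulrA ler_wpM2l ?(growth_ge0 fc)// mulrCA.
Qed.

Lemma tempered_eq f g : (forall w, f w = g w) -> tempered f -> tempered g.
Proof. by move=> fg; rewrite (_ : f = g)//; exact/funext. Qed.

Lemma temperedZ (a : R) f : tempered f -> tempered (fun w => a * f w).
Proof. by move=> tf; apply: (temperedM (tempered_cst a) tf). Qed.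

Lemma temperedN f : tempered f -> tempered (fun w => - f w).
Proof. by move=> /(temperedZ (-1)); apply: tempered_eq => w; rewrite mulN1r. Qed.

Lemma tempered_sum (J : Type) (r : seq J) (Q : pred J) (F : J -> (I -> R) -> R) :
  (forall j, Q j -> tempered (F j)) -> tempered (fun w => \sum_(j <- r | Q j) F j w).
Proof.
move=> tF; elim: r => [|j r IH].
  by apply: tempered_eq (tempered_cst 0) => w; rewrite big_nil.
case Qj: (Q j); last by apply: tempered_eq IH => w; rewrite big_cons Qj.
by apply: tempered_eq (temperedD (tF j Qj) IH) => w; rewrite big_cons Qj.
Qed.

Lemma tempered_prod (J : Type) (r : seq J) (Q : pred J) (F : J -> (I -> R) -> R) :
  (forall j, Q j -> tempered (F j)) -> tempered (fun w => \prod_(j <- r | Q j) F j w).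
Proof.
move=> tF; elim: r => [|j r IH].
  by apply: tempered_eq (tempered_cst 1) => w; rewrite big_nil.
case Qj: (Q j); last by apply: tempered_eq IH => w; rewrite big_cons Qj.
by apply: tempered_eq (temperedM (tF j Qj) IH) => w; rewrite big_cons Qj.
Qed.

(** Up to the number of terms, a sum of nonnegative reals is its largest term. *)
Lemma sum_exprn_le (i0 : I) (b : I -> R) (d : nat) : (forall i, 0 <= b i) ->
  (\sum_i b i) ^+ d <= #|I|%:R ^+ d * \sum_i b i ^+ d.
Proof.
move=> b0; pose m := [arg max_(i > i0) b i]%O.
have bm i : b i <= b m by rewrite /m; case: arg_maxP => // j _; apply.
apply: (@le_trans _ _ ((#|I|%:R * b m) ^+ d)).
  apply: lerXn2r; rewrite ?nnegrE ?sumr_ge0// ?mulr_ge0//.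
  by rewrite mulr_natl -sumr_const; apply: ler_sum.
rewrite exprMn ler_wpM2l ?exprn_ge0// (bigD1 m)//= lerDl.
by apply: sumr_ge0 => i _; exact: exprn_ge0.
Qed.

Lemma weight_update w i x : weight (update w i x) <= weight w * (1 + `|x|).
Proof.
rewrite mulrDr mulr1 /weight; apply: (@le_trans _ _ (1 + \sum_j `|w j| + `|x|)).
  rewrite (bigD1 i)//= [X in _ <= 1 + X + _](bigD1 i)//= /update eqxx.
  rewrite (eq_bigr (fun j => `|w j|)) => [|j /negPf -> //].
  by have := normr_ge0 (w i); lra.
by rewrite lerD2l ler_peMl// weight_ge1.
Qed.

End Tempered.

Section SteinFamily.
Context {R : realType} {I : finType} d (T : measurableType d).
Variables (P : probability T R) (X : I -> {RV P >-> R}).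
Hypothesis X_iid : iid_standard_normal X.
Notation S := (coord_space R I).
Notation gauss := (normal_prob (0 : R) 1).
Notation joint := (joint X).

(** A power of the weight is dominated by a sum of functions of one coordinate
    each, whose integrability only involves the law of that coordinate. *)
Lemma integrable_tempered (i0 : I) (f : (I -> R) -> R) : tempered f ->
  P.-integrable setT (fun t => (f (joint t))%:E).
Proof.
move=> [mf [c [m fc]]].
have h i : P.-integrable setT (fun t => ((1 + `|X i t|) ^+ m)%:E).
  pose g (x : R) := ((1 + `|x|) ^+ m)%:E.
  have mg0 : measurable_fun setT (fun x : R => (1 + `|x|) ^+ m).
    by apply: measurable_funX; apply: measurable_funD => //; exact: measurableT_comp.
  have mg : measurable_fun setT g by exact/measurable_EFinP.
  have gi : gauss.-integrable setT g.
    apply: (@integrable_poly_normal_prob _ (fun x => (1 + `|x|) ^+ m) 1 m) => // x.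
    by rewrite mul1r ger0_norm// exprn_ge0// addr_ge0.
  apply/integrableP; split.
    by apply: (measurableT_comp mg); exact: measurable_funP.
  have /integrableP[_] := gi; apply: le_lt_trans.
  have mXi : measurable_fun setT (X i : T -> measurableTypeR R).
    exact: (@measurable_funPT _ _ _ _ (X i)).
  pose Xi : {mfun T >-> measurableTypeR R} := HB.pack (X i : T -> measurableTypeR R)
    (isMeasurableFun.Build _ _ T (measurableTypeR R) _ mXi).
  have E : (\int[distribution P Xi]_x `|g x| = \int[P]_t `|g (X i t)|)%E.
    by rewrite ge0_integral_distribution//; exact: measurableT_comp.
  rewrite -[leLHS]E.
  have <- : (\int[distribution P Xi]_x `|g x| = \int[gauss]_x `|g x|)%E.
    apply: eq_measure_integral => A mA _; have [_ law] := X_iid; exact: (law i).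
  exact: lexx.
have s : P.-integrable setT (fun t => \sum_(i <- index_enum I) ((1 + `|X i t|) ^+ m)%:E)%E.
  by apply: integrable_sum => // i _; exact: h.
have {}s := integrableZl measurableT (c * #|I|%:R ^+ m) s.
apply: le_integrable s => //.
  by apply/measurable_EFinP; apply: (measurableT_comp mf); exact: measurable_joint.
move=> t _; rewrite sumEFin -EFinM /= lee_fin.
apply: le_trans (fc _) _; rewrite -mulrA ger0_norm; last first.
  by rewrite !mulr_ge0 ?(growth_ge0 fc)// ?exprn_ge0// sumr_ge0// => i _;
     rewrite exprn_ge0// addr_ge0.
rewrite ler_wpM2l ?(growth_ge0 fc)//.
apply: le_trans (sum_exprn_le i0 _ _); last by move=> i; rewrite addr_ge0.
apply: lerXn2r; rewrite ?nnegrE.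
- by rewrite (le_trans _ (weight_ge1 _)).
- by apply: sumr_ge0 => i _; rewrite addr_ge0.
by rewrite big_split /= lerD2r sumr_const ler1n; apply/card_gt0P; exists i0.
Qed.

(** Stein's identity, one coordinate at a time: condition on the other
    coordinates and integrate by parts on the line. *)
Lemma stein_identity (i : I) (f f' : (I -> R) -> R) :
  tempered f -> tempered f' ->
  (forall w (x : R), is_derive x 1 (fun y => f (update w i y)) (f' (update w i x))) ->
  (forall w, continuous (fun y : R => f' (update w i y))) ->
  (\int[P]_t (joint t i * f (joint t))%:E = \int[P]_t (f' (joint t))%:E)%E.
Proof.
move=> tf tf' df cf'.
have txf := temperedM (tempered_coord i) tf.
rewrite (integral_resample X_iid i txf.1 (integrable_tempered i txf)).
rewrite (integral_resample X_iid i tf'.1 (integrable_tempered i tf')).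
apply: eq_integral => t _; move: (joint t) => w {t}.
have [_ [c [m fc]]] := tf; have [_ [c' [m' fc']]] := tf'.
have s1 := weight_ge1 w.
pose C := (c + c') * weight w ^+ (m + m').
have bd (g : (I -> R) -> R) a k : 0 <= a -> (k <= m + m')%N -> a <= c + c' ->
    (forall w, `|g w| <= a * weight w ^+ k) ->
    forall x, `|g (update w i x)| <= C * (1 + `|x|) ^+ (m + m').
  move=> a0 km ac gk x; apply: le_trans (gk _) _; rewrite /C -mulrA -exprMn.
  have s2 : 1 <= weight w * (1 + `|x|) by rewrite mulr_ege1// lerDl.
  apply: ler_pM => //.
    by rewrite exprn_ge0// (le_trans _ (weight_ge1 _)).
  apply: (@le_trans _ _ ((weight w * (1 + `|x|)) ^+ k)); last exact: ler_weXn2l.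
  apply: lerXn2r; rewrite ?nnegrE.
  - by rewrite (le_trans _ (weight_ge1 _)).
  - by rewrite (le_trans _ s2).
  - exact: weight_update.
have c0 := growth_ge0 fc; have c'0 := growth_ge0 fc'.
have bf : forall x, `|f (update w i x)| <= C * (1 + `|x|) ^+ (m + m').
  by apply: (bd f c m) => //; rewrite ?leq_addr// lerDl.
have bf' : forall x, `|f' (update w i x)| <= C * (1 + `|x|) ^+ (m + m').
  by apply: (bd f' c' m') => //; rewrite ?leq_addl// lerDr.
rewrite -(gauss_by_parts (df w) (cf' w) bf bf').
by apply: eq_integral => x _; rewrite /update eqxx.
Qed.

End SteinFamily.

(** * The Frobenius norm of matrices *)

Section FrobeniusMatrix.
Context {R : realFieldType}.

(** The square of the Frobenius norm, as a trace so that the matrix identities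
    below apply to it. *)
Definition sqnorm m q (A : 'M[R]_(m, q)) : R := \tr (A *m A^T).

Lemma sqnormE m q (A : 'M[R]_(m, q)) : sqnorm A = \sum_i \sum_j A i j ^+ 2.
Proof.
by apply: eq_bigr => i _; rewrite mxE; apply: eq_bigr => j _; rewrite mxE -expr2.
Qed.

Lemma sqnorm_ge0 m q (A : 'M[R]_(m, q)) : 0 <= sqnorm A.
Proof. by rewrite sqnormE; do 2 apply: sumr_ge0 => ? _; exact: sqr_ge0. Qed.

Lemma sqnorm_tr m q (A : 'M[R]_(m, q)) : sqnorm A^T = sqnorm A.
Proof. by rewrite /sqnorm trmxK mxtrace_mulC. Qed.

Lemma sqnorm_eq0 m q (A : 'M[R]_(m, q)) : sqnorm A = 0 -> A = 0.
Proof.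
rewrite sqnormE => /eqP; rewrite psumr_eq0 => [/allP h|i _]; last first.
  by apply: sumr_ge0 => j _; exact: sqr_ge0.
apply/matrixP => i j; rewrite mxE; apply/eqP; rewrite -sqrf_eq0.
have := h i (mem_index_enum _); rewrite psumr_eq0 => [|j' _]; last exact: sqr_ge0.
by move=> /allP /(_ j (mem_index_enum _)).
Qed.

Lemma sqnormD m q (A B : 'M[R]_(m, q)) :
  sqnorm (A + B) = sqnorm A + 2 * \tr (A *m B^T) + sqnorm B.
Proof.
rewrite /sqnorm linearD /= mulmxDl !mulmxDr !mxtraceD.
have -> : \tr (B *m A^T) = \tr (A *m B^T) by rewrite -mxtrace_tr trmx_mul trmxK.
ring.
Qed.

Lemma sqnormZ m q (a : R) (A : 'M[R]_(m, q)) : sqnorm (a *: A) = a ^+ 2 * sqnorm A.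
Proof. by rewrite /sqnorm linearZ /= -scalemxAl -scalemxAr scalerA mxtraceZ expr2. Qed.

Lemma sqnormN m q (A : 'M[R]_(m, q)) : sqnorm (- A) = sqnorm A.
Proof. by rewrite -scaleN1r sqnormZ sqrrN expr1n mul1r. Qed.

Lemma sqnorm_rows m q (A : 'M[R]_(m, q)) : sqnorm A = \sum_i sqnorm (row i A).
Proof.
rewrite sqnormE; apply: eq_bigr => i _; rewrite sqnormE big_ord1.
by apply: eq_bigr => j _; rewrite mxE.
Qed.

(** Young's inequality: a cross term costs little if one of the two summands
    is allowed a large factor. *)
Lemma sqnormB_young m q (A B : 'M[R]_(m, q)) (e : R) : 0 < e ->
  sqnorm (A - B) <= (1 + e^-1) * sqnorm A + (1 + e) * sqnorm B.
Proof.
move=> e0; have h : 0 <= e * sqnorm (e^-1 *: A + B).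
  by rewrite mulr_ge0 ?sqnorm_ge0// ltW.
move: h; rewrite !sqnormD sqnormZ sqnormN linearN /= mulmxN raddfN /=.
rewrite -scalemxAl mxtraceZ; set t := \tr _; set a := sqnorm A; set b := sqnorm B.
have -> : e * (e^-1 ^+ 2 * a + 2 * (e^-1 * t) + b) = e^-1 * a + 2 * t + e * b.
  by field; rewrite gt_eqF.
lra.
Qed.

(** Cauchy-Schwarz: the residual of [A] along [B] has a nonnegative squared
    norm. *)
Lemma sqr_mxtrace_le m q (A B : 'M[R]_(m, q)) :
  (\tr (A *m B^T)) ^+ 2 <= sqnorm A * sqnorm B.
Proof.
have [b0|b0] := eqVneq (sqnorm B) 0.
  by rewrite (sqnorm_eq0 b0) trmx0 mulmx0 mxtrace0 expr0n mulr_ge0 ?sqnorm_ge0.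
have bgt : 0 < sqnorm B by rewrite lt_def b0 sqnorm_ge0.
pose t := \tr (A *m B^T).
have := sqnorm_ge0 (A + (- (t / sqnorm B)) *: B).
rewrite sqnormD sqnormZ linearZ /= -scalemxAr mxtraceZ -/t.
have -> : sqnorm A + 2 * (- (t / sqnorm B) * t) + (- (t / sqnorm B)) ^+ 2 * sqnorm B
  = (sqnorm A * sqnorm B - t ^+ 2) / sqnorm B by field.
by rewrite pmulr_lge0 ?invr_gt0// subr_ge0.
Qed.

(** Cauchy-Schwarz for each entry of the product. *)
Lemma sqnorm_mulmx m q r (A : 'M[R]_(m, q)) (B : 'M[R]_(q, r)) :
  sqnorm (A *m B) <= sqnorm A * sqnorm B.
Proof.
rewrite -(sqnorm_tr B) (sqnorm_rows A) (sqnorm_rows B^T) sqnormE mulr_suml.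
apply: ler_sum => i _; rewrite mulr_sumr; apply: ler_sum => j _.
have -> : (A *m B) i j = \tr (row i A *m (row j B^T)^T).
  rewrite trace_mx11 !mxE; apply: eq_bigr => k _; by rewrite !mxE.
exact: sqr_mxtrace_le.
Qed.

End FrobeniusMatrix.

Lemma sqnorm_isometry (R : realFieldType) n l m (Q : 'M[R]_(n, l)) (Z : 'M[R]_(l, m)) :
  Q^T *m Q = 1%:M -> sqnorm (Q *m Z) = sqnorm Z.
Proof.
move=> QQ; rewrite /sqnorm mxtrace_mulC trmx_mul mulmxA -(mulmxA Z^T) QQ mulmx1.
exact: mxtrace_mulC.
Qed.

Lemma sqrt_sqnormD (R : rcfType) m q (A B : 'M[R]_(m, q)) :
  Num.sqrt (sqnorm (A + B)) <= Num.sqrt (sqnorm A) + Num.sqrt (sqnorm B).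
Proof.
set a := Num.sqrt (sqnorm A); set b := Num.sqrt (sqnorm B).
have a0 : 0 <= a by exact: sqrtr_ge0. have b0 : 0 <= b by exact: sqrtr_ge0.
have a2 : a ^+ 2 = sqnorm A by rewrite sqr_sqrtr ?sqnorm_ge0.
have b2 : b ^+ 2 = sqnorm B by rewrite sqr_sqrtr ?sqnorm_ge0.
rewrite -[leRHS]ger0_norm ?addr_ge0// -sqrtr_sqr; apply: ler_wsqrtr.
have : \tr (A *m B^T) <= a * b.
  apply: le_trans (ler_norm _) _.
  rewrite -(@ler_pXn2r _ 2)// ?nnegrE ?mulr_ge0// real_normK ?num_real// exprMn a2 b2.
  exact: sqr_mxtrace_le.
rewrite sqnormD -a2 -b2 sqrrD; lra.
Qed.

(** * The regularized inverse of a Gram matrix *)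

Section Resolvent.
Context {R : realFieldType} (m l : nat).
Variables (eps : R).
Hypotheses (eps_gt0 : 0 < eps).
Implicit Types (G : 'M[R]_(m, l)).

Definition gram G : 'M[R]_m := G *m G^T + eps%:M.
(** The shift by [eps] makes the inverse exist, with entries at most [eps^-1],
    whatever the rank of [G]. *)
Definition resolvent G : 'M[R]_m := invmx (gram G).

(** A row [v] of the kernel satisfies [|v G|^2 + eps |v|^2 = 0]. *)
Lemma gram_unit G : gram G \in unitmx.
Proof.
rewrite -row_free_unit -kermx_eq0; apply/eqP/row_matrixP => i.
rewrite row0; set v := row i _.
have : v *m gram G = 0 by rewrite -row_mul mulmx_ker row0.
move=> /(congr1 (fun u => \tr (u *m v^T))); rewrite mul0mx mxtrace0.
rewrite mulmxDr mulmxDl mxtraceD mul_mx_scalar -scalemxAl mxtraceZ -/(sqnorm v).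
have -> : \tr (v *m (G *m G^T) *m v^T) = sqnorm (v *m G).
  by rewrite /sqnorm trmx_mul !mulmxA.
move=> /eqP; rewrite paddr_eq0 ?sqnorm_ge0 ?mulr_ge0 ?sqnorm_ge0 ?ltW//.
by move=> /andP[_]; rewrite mulf_eq0 (gt_eqF eps_gt0) /= => /eqP /sqnorm_eq0.
Qed.

Variables (G : 'M[R]_(m, l)) (Pi : 'M[R]_m).
Hypotheses (Pi_sym : Pi^T = Pi) (Pi_idem : Pi *m Pi = Pi) (Pi_G : Pi *m G = G).
Notation S := (resolvent G).
Notation B := (gram G).
Notation K := (S *m G).

Lemma gram_sym : B^T = B.
Proof. by rewrite linearD /= trmx_mul trmxK tr_scalar_mx. Qed.

Lemma resolvent_sym : S^T = S.
Proof. by rewrite trmx_inv gram_sym. Qed.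

Lemma mul_gram_resolvent : B *m S = 1%:M.
Proof. by rewrite mulmxV ?gram_unit. Qed.

Lemma mul_resolvent_gram : S *m B = 1%:M.
Proof. by rewrite mulVmx ?gram_unit. Qed.

Lemma GT_Pi : G^T *m Pi = G^T.
Proof. by rewrite -{1}Pi_sym -trmx_mul Pi_G. Qed.

Lemma resolvent_comm : Pi *m S = S *m Pi.
Proof.
have c : Pi *m B = B *m Pi.
  rewrite mulmxDr mulmxDl mulmxA Pi_G; congr (_ + _); last exact: scalar_mxC.
  by rewrite -[RHS]mulmxA GT_Pi.
transitivity (S *m (B *m Pi) *m S).
  by rewrite !mulmxA mul_resolvent_gram mul1mx.
by rewrite -c -!mulmxA mul_gram_resolvent mulmx1.
Qed.

Lemma mul_GGT_resolvent : G *m G^T *m S = 1%:M - eps *: S.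
Proof.
by rewrite -mul_gram_resolvent mulmxDl mul_scalar_mx addrK.
Qed.

Lemma mul_resolvent_GGT : S *m (G *m G^T) = 1%:M - eps *: S.
Proof.
by rewrite -mul_resolvent_gram mulmxDr mul_mx_scalar addrK.
Qed.

(** The trace of this identity against [Pi] controls the norm of [K], and its
    diagonal, nonnegative on the left, bounds the entries of [S]. *)
Lemma KKT : K *m K^T = S - eps *: (S *m S).
Proof.
by rewrite trmx_mul resolvent_sym !mulmxA -(mulmxA S) -mulmxA mulmxA mul_resolvent_GGT
  mulmxBl mul1mx -scalemxAl.
Qed.

Lemma Pi_K : Pi *m K = K.
Proof. by rewrite mulmxA resolvent_comm -mulmxA Pi_G. Qed.

Lemma sqnorm_K : sqnorm K = \tr (S *m Pi) - eps * sqnorm (S *m Pi).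
Proof.
rewrite /sqnorm -{1}Pi_K -[Pi *m K *m _]mulmxA KKT mulmxBr raddfB /= -scalemxAr mxtraceZ.
rewrite resolvent_comm; congr (_ - _ * _).
rewrite trmx_mul Pi_sym resolvent_sym [in RHS]mulmxA -[S *m Pi *m Pi]mulmxA Pi_idem.
by rewrite -resolvent_comm mulmxA.
Qed.

Lemma tr_resolvent_proj_ge0 : 0 <= \tr (S *m Pi).
Proof.
have := sqnorm_ge0 K; rewrite sqnorm_K subr_ge0; apply: le_trans.
by rewrite mulr_ge0 ?sqnorm_ge0// ltW.
Qed.

Lemma sqnorm_K_le : sqnorm K <= \tr (S *m Pi).
Proof. by rewrite sqnorm_K gerBl mulr_ge0 ?sqnorm_ge0// ltW. Qed.

Lemma sqnorm_resolvent_proj_le : eps * sqnorm (S *m Pi) <= \tr (S *m Pi).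
Proof. by rewrite -subr_ge0 -sqnorm_K sqnorm_ge0. Qed.

Lemma tr_GTK : \tr (G^T *m K) = \tr Pi - eps * \tr (S *m Pi).
Proof.
rewrite mxtrace_mulC -Pi_K -mulmxA -mulmxA mul_resolvent_GGT mulmxBr mulmx1.
by rewrite raddfB /= -scalemxAr mxtraceZ resolvent_comm.
Qed.

(** The diagonal entries of [K K^T] are nonnegative, so that
    [eps * |S_i|^2 <= S i i] for each row [S_i]; in particular
    [S i i <= eps^-1]. *)
Lemma resolvent_entry i j : `|S i j| <= eps^-1.
Proof.
have h : eps * S i i ^+ 2 <= S i i /\ eps * S i j ^+ 2 <= S i i.
  have e0 : 0 <= (K *m K^T) i i.
    by rewrite mxE; apply: sumr_ge0 => k _; rewrite [K^T _ _]mxE -expr2 sqr_ge0.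
  have e1 : eps * \sum_k S i k ^+ 2 <= S i i.
    move: e0; rewrite KKT !mxE subr_ge0 (eq_bigr (fun k => S i k ^+ 2))// => k _.
    by rewrite expr2 -{2}resolvent_sym mxE.
  have e2 k : eps * S i k ^+ 2 <= S i i.
    apply: le_trans e1; rewrite ler_pM2l// (bigD1 k)//= lerDl.
    by apply: sumr_ge0 => k' _; exact: sqr_ge0.
  by split; exact: e2.
have [h1 h2] := h.
have s0 : 0 <= S i i by apply: le_trans h1; rewrite mulr_ge0 ?sqr_ge0// ltW.
have s1 : S i i <= eps^-1.
  have [->|sn0] := eqVneq (S i i) 0; first by rewrite invr_ge0 ltW.
  have sgt : 0 < S i i by rewrite lt_def sn0.
  by rewrite -[leRHS]mul1r ler_pdivlMr// mulrC -(ler_pM2r sgt) mul1r -mulrA -expr2.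
have ei : 0 <= eps^-1 by rewrite invr_ge0 ltW.
rewrite -(@ler_pXn2r _ 2)// real_normK ?num_real//.
have h3 : S i j ^+ 2 <= eps^-1 * S i i by rewrite ler_pdivlMl.
by apply: le_trans h3 _; rewrite expr2 ler_pM2l ?invr_gt0.
Qed.

End Resolvent.

(** * Matrix-valued functions of a Gaussian family *)

Section MatrixDerivative.
Context {R : realType}.
Implicit Types (x : R).

Lemma is_derive_uniq (f : R -> R) x a b :
  is_derive x 1 f a -> is_derive x 1 f b -> a = b.
Proof. by move=> [_ <-] [_ <-]. Qed.

Lemma is_derive_bigsum (J : Type) (r : seq J) (F : J -> R -> R) (dF : J -> R) x :
  (forall j, is_derive x 1 (F j) (dF j)) ->
  is_derive x 1 (fun y => \sum_(j <- r) F j y) (\sum_(j <- r) dF j).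
Proof.
move=> h; elim: r => [|j r IH].
  rewrite big_nil (_ : (fun _ => _) = cst 0); first exact: is_derive_cst.
  by apply/funext => y; rewrite big_nil.
rewrite big_cons (_ : (fun _ => _) = F j + (fun y => \sum_(j <- r) F j y)).
  exact: is_deriveD.
by apply/funext => y; rewrite big_cons.
Qed.

Lemma derivable_bigsum (J : Type) (r : seq J) (F : J -> R -> R) x :
  (forall j, derivable (F j) x 1) -> derivable (fun y => \sum_(j <- r) F j y) x 1.
Proof.
by move=> h; have [] := @is_derive_bigsum J r F _ x (fun j => derivableP (h j)).
Qed.

Lemma derivable_bigprod (J : Type) (r : seq J) (F : J -> R -> R) x :
  (forall j, derivable (F j) x 1) -> derivable (fun y => \prod_(j <- r) F j y) x 1.
Proof.
move=> h; elim: r => [|j r IH].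
  rewrite (_ : (fun _ => _) = cst 1); first exact: derivable_cst.
  by apply/funext => y; rewrite big_nil.
rewrite (_ : (fun _ => _) = F j * (fun y => \prod_(j <- r) F j y)).
  exact: derivableM.
by apply/funext => y; rewrite big_cons.
Qed.

Definition mderiv m q (F : R -> 'M[R]_(m, q)) x (dF : 'M[R]_(m, q)) :=
  forall i j, is_derive x 1 (fun y => F y i j) (dF i j).

Definition mderivable m q (F : R -> 'M[R]_(m, q)) x :=
  forall i j, derivable (fun y => F y i j) x 1.

Lemma mderiv_derivable m q (F : R -> 'M[R]_(m, q)) x dF :
  mderiv F x dF -> mderivable F x.
Proof. by move=> h i j; have [] := h i j. Qed.

Lemma mderivableP m q (F : R -> 'M[R]_(m, q)) x :
  mderivable F x -> exists dF, mderiv F x dF.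
Proof.
move=> h; exists (\matrix_(i, j) 'D_1 (fun y => F y i j) x) => i j; rewrite mxE.
exact: derivableP.
Qed.

Lemma mderiv_eq m q (F : R -> 'M[R]_(m, q)) x dF dF' :
  mderiv F x dF -> dF = dF' -> mderiv F x dF'.
Proof. by move=> + <-. Qed.

Lemma mderiv_cst m q (A : 'M[R]_(m, q)) x : mderiv (fun=> A) x 0.
Proof. by move=> i j; rewrite mxE; exact: is_derive_cst. Qed.

Lemma mderivD m q (F H : R -> 'M[R]_(m, q)) x dF dH :
  mderiv F x dF -> mderiv H x dH -> mderiv (fun y => F y + H y) x (dF + dH).
Proof.
move=> hF hH i j; rewrite mxE (_ : (fun _ => _) = (fun y => F y i j) + (fun y => H y i j)).
  exact: is_deriveD.
by apply/funext => y; rewrite mxE.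
Qed.

Lemma mderivM m q r (F : R -> 'M[R]_(m, q)) (H : R -> 'M[R]_(q, r)) x dF dH :
  mderiv F x dF -> mderiv H x dH ->
  mderiv (fun y => F y *m H y) x (dF *m H x + F x *m dH).
Proof.
move=> hF hH i j.
rewrite (_ : (fun _ => _) = (fun y => \sum_k F y i k * H y k j)); last first.
  by apply/funext => y; rewrite mxE.
rewrite !mxE -big_split /=; apply: is_derive_bigsum => k.
have := is_deriveM (hF i k) (hH k j).
by move=> h; apply: (is_derive_eq h); rewrite /GRing.scale /=; ring.
Qed.

Lemma mderiv_tr m q (F : R -> 'M[R]_(m, q)) x dF :
  mderiv F x dF -> mderiv (fun y => (F y)^T) x dF^T.
Proof.
move=> h i j; rewrite mxE (_ : (fun _ => _) = (fun y => F y j i))//.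
by apply/funext => y; rewrite mxE.
Qed.

Lemma derivable_det m (F : R -> 'M[R]_m) x :
  mderivable F x -> derivable (fun y => \det (F y)) x 1.
Proof.
move=> h; apply: derivable_bigsum => s; apply: derivableM; first exact: derivable_cst.
by apply: derivable_bigprod => i; exact: h.
Qed.

Lemma invmx_entry m (A : 'M[R]_m) i j : A \in unitmx ->
  invmx A i j = (\det A)^-1 * cofactor A j i.
Proof. by move=> uA; rewrite /invmx uA !mxE. Qed.

Lemma mderivable_inv m (F : R -> 'M[R]_m) x :
  (forall y, F y \in unitmx) -> mderivable F x -> mderivable (fun y => invmx (F y)) x.
Proof.
move=> uF hF i j.
rewrite (_ : (fun _ => _) = (fun y => (\det (F y))^-1) * (fun y => cofactor (F y) j i)).
  apply: derivableM.
    apply: derivableV; last exact: derivable_det.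
    by have := uF x; rewrite unitmxE unitfE.
  apply: derivableM; first exact: derivable_cst.
  apply: derivable_det => a b.
  rewrite (_ : (fun _ => _) = (fun y => F y (lift j a) (lift i b)))//.
  by apply/funext => y; rewrite !mxE.
by apply/funext => y; rewrite invmx_entry.
Qed.

(** Differentiate [F y *m invmx (F y) = 1%:M]. *)
Lemma mderiv_inv m (F : R -> 'M[R]_m) x dF :
  (forall y, F y \in unitmx) -> mderiv F x dF ->
  mderiv (fun y => invmx (F y)) x (- (invmx (F x) *m dF *m invmx (F x))).
Proof.
move=> uF hF.
have [D hD] := mderivableP (mderivable_inv uF (mderiv_derivable hF)).
apply: (mderiv_eq hD).
have h := mderivM hF hD.
have e : dF *m invmx (F x) + F x *m D = 0.
  apply/matrixP => i j; apply: (is_derive_uniq (h i j)).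
  under eq_fun do rewrite mulmxV//; rewrite [X in is_derive _ _ _ X]mxE.
  exact: (is_derive_cst ((1%:M : 'M[R]_m) i j) x 1).
have -> : D = invmx (F x) *m (F x *m D) by rewrite mulKmx.
by move/eqP: e; rewrite addrC addr_eq0 => /eqP ->; rewrite mulmxN mulmxA.
Qed.

End MatrixDerivative.

Section AdmissibleMatrix.
Context {R : realType} {I : finType}.
Notation S := (coord_space R I).

Lemma measurable_invr_neq0 (f : (I -> R) -> R) : measurable_fun (setT : set S) f ->
  (forall w, f w != 0) -> measurable_fun (setT : set S) (fun w => (f w)^-1).
Proof.
move=> mf f0.
(* [1 / x = x / x ^ 2 = x * exp (- ln (x ^ 2))], made of measurable functions. *)
rewrite (_ : (fun _ => _) = (fun w => f w * expR (- ln (f w ^+ 2)))).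
  apply: measurable_funM => //; apply: measurableT_comp => //.
  apply: measurableT_comp => //; apply: measurableT_comp; first exact: measurable_ln.
  exact: measurable_funX.
apply/funext => w; rewrite expRN lnK ?posrE ?exprn_even_gt0//=.
by rewrite expr2 invfM mulrA divff// mul1r.
Qed.

(** Matrix functions of the family of coordinates to which Stein's identity
    applies, entry by entry. *)
Definition admissible m q (F : (I -> R) -> 'M[R]_(m, q)) :=
  (forall a b, tempered (fun w => F w a b)) /\
  (forall w i x, mderivable (fun y => F (update w i y)) x).

Lemma admissible_cst m q (A : 'M[R]_(m, q)) : admissible (fun=> A).
Proof.
split=> [a b|w i x]; first exact: tempered_cst.
exact: mderiv_derivable (mderiv_cst A x).
Qed.

Lemma admissibleD m q (F H : (I -> R) -> 'M[R]_(m, q)) :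
  admissible F -> admissible H -> admissible (fun w => F w + H w).
Proof.
move=> [tF dF] [tH dH]; split=> [a b|w i x].
  by apply: tempered_eq (temperedD (tF a b) (tH a b)) => w; rewrite mxE.
have [D1 h1] := mderivableP (dF w i x); have [D2 h2] := mderivableP (dH w i x).
exact: mderiv_derivable (mderivD h1 h2).
Qed.

Lemma admissibleM m q r (F : (I -> R) -> 'M[R]_(m, q)) (H : (I -> R) -> 'M[R]_(q, r)) :
  admissible F -> admissible H -> admissible (fun w => F w *m H w).
Proof.
move=> [tF dF] [tH dH]; split=> [a b|w i x].
  have t : tempered (fun w => \sum_k F w a k * H w k b).
    by apply: tempered_sum => k _; exact: temperedM.
  by apply: tempered_eq t => w; rewrite mxE.
have [D1 h1] := mderivableP (dF w i x); have [D2 h2] := mderivableP (dH w i x).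
exact: mderiv_derivable (mderivM h1 h2).
Qed.

Lemma admissible_tr m q (F : (I -> R) -> 'M[R]_(m, q)) :
  admissible F -> admissible (fun w => (F w)^T).
Proof.
move=> [tF dF]; split=> [a b|w i x].
  by apply: tempered_eq (tF b a) => w; rewrite mxE.
have [D h] := mderivableP (dF w i x); exact: mderiv_derivable (mderiv_tr h).
Qed.

Lemma admissibleN m q (F : (I -> R) -> 'M[R]_(m, q)) :
  admissible F -> admissible (fun w => - F w).
Proof.
move=> nF; have := admissibleM (admissible_cst (-1)%:M) nF.
rewrite (_ : (fun _ => _) = (fun w => - F w))//.
by apply/funext => w; rewrite mul_scalar_mx scaleN1r.
Qed.

Lemma tempered_mxtrace m (F : (I -> R) -> 'M[R]_m) :
  admissible F -> tempered (fun w => \tr (F w)).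
Proof. by move=> [tF _]; apply: tempered_sum => i _. Qed.

Lemma tempered_det m (F : (I -> R) -> 'M[R]_m) :
  (forall a b, tempered (fun w => F w a b)) -> tempered (fun w => \det (F w)).
Proof.
move=> tF; apply: tempered_sum => s _; apply: temperedZ.
by apply: tempered_prod => i _.
Qed.

(** Entries of the inverse are quotients of determinants, hence measurable and
    differentiable; their growth is controlled by [resolvent_entry] rather than
    through the determinant. *)
Lemma admissible_resolvent m l (eps : R) (G : (I -> R) -> 'M[R]_(m, l)) : 0 < eps ->
  admissible G -> admissible (fun w => resolvent eps (G w)).
Proof.
move=> e0 nG.
have nB : admissible (fun w => gram eps (G w)).
  by apply: admissibleD (admissible_cst _); apply: admissibleM => //; exact: admissible_tr.
split=> [a b|w i x]; last first.
  apply: (mderivable_inv (F := fun y => gram eps (G (update w i y)))); last exact: nB.2.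
  by move=> y; exact: gram_unit.
apply: (@tempered_bounded _ _ _ eps^-1); last by move=> w; exact: resolvent_entry.
rewrite (_ : (fun _ => _) =
  (fun w => (\det (gram eps (G w)))^-1 * cofactor (gram eps (G w)) b a)).
  apply: measurable_funM; first apply: measurable_invr_neq0.
  - by have [] := tempered_det nB.1.
  - by move=> w; have := gram_unit e0 (G w); rewrite unitmxE unitfE.
  - suff [] : tempered (fun w => cofactor (gram eps (G w)) b a) by [].
    apply: temperedZ; apply: tempered_det => i j.
    by apply: tempered_eq (nB.1 (lift b i) (lift a j)) => w; rewrite !mxE.
by apply/funext => w; rewrite /resolvent invmx_entry// gram_unit.
Qed.

End AdmissibleMatrix.

(** * Stein's identity for a Gaussian matrix *)

Section DeltaSums.
Context {R : realFieldType} (m l : nat).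

Lemma mul_deltaE (X : 'M[R]_m) (Y : 'M[R]_l) a b :
  (X *m delta_mx a b *m Y) a b = X a a * Y b b.
Proof.
rewrite mxE (bigD1 b)//= big1 ?addr0 => [|k kb]; last first.
  rewrite mxE big1 ?mul0r// => i _; rewrite mxE (negPf kb) andbF mulr0//.
rewrite mxE (bigD1 a)//= big1 ?addr0 => [|k ka]; last by rewrite mxE (negPf ka) mulr0.
by rewrite mxE !eqxx mulr1.
Qed.

Lemma mul_delta_trE (X Y : 'M[R]_(m, l)) a b :
  (X *m (delta_mx a b)^T *m Y) a b = X a b * Y a b.
Proof.
rewrite trmx_delta mxE (bigD1 a)//= big1 ?addr0 => [|k ka]; last first.
  rewrite mxE big1 ?mul0r// => i _; rewrite mxE (negPf ka) andbF mulr0//.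
rewrite mxE (bigD1 b)//= big1 ?addr0 => [|k kb]; last by rewrite mxE (negPf kb) mulr0.
by rewrite mxE !eqxx mulr1.
Qed.

(** The divergence of a matrix-valued function sums, over [a] and [b], the entry
    [(a, b)] of its derivative in the direction [E = delta_mx a b]. The
    derivatives met here are sums of terms [X *m E *m Y] and [X *m E^T *m Y],
    whose contributions are evaluated separately. *)
Lemma sum_delta (X : 'M[R]_m) (Y : 'M[R]_l) :
  \sum_a \sum_b (X *m delta_mx a b *m Y) a b = \tr X * \tr Y.
Proof.
rewrite mulr_suml; apply: eq_bigr => a _; rewrite mulr_sumr.
by apply: eq_bigr => b _; rewrite mul_deltaE.
Qed.

Lemma sum_delta_tr (X Y : 'M[R]_(m, l)) :
  \sum_a \sum_b (X *m (delta_mx a b)^T *m Y) a b = \tr (X^T *m Y).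
Proof.
rewrite exchange_big; apply: eq_bigr => b _; rewrite mxE.
by apply: eq_bigr => a _; rewrite mul_delta_trE mxE.
Qed.

Lemma sum_mxD (F H : 'I_m -> 'I_l -> 'M[R]_(m, l)) :
  \sum_a \sum_b (F a b + H a b) a b =
  \sum_a \sum_b F a b a b + \sum_a \sum_b H a b a b.
Proof.
rewrite -big_split; apply: eq_bigr => a _; rewrite -big_split.
by apply: eq_bigr => b _; rewrite mxE.
Qed.

Lemma sum_mxN (F : 'I_m -> 'I_l -> 'M[R]_(m, l)) :
  \sum_a \sum_b (- F a b) a b = - \sum_a \sum_b F a b a b.
Proof.
rewrite -sumrN; apply: eq_bigr => a _; rewrite -sumrN.
by apply: eq_bigr => b _; rewrite mxE.
Qed.

End DeltaSums.

Section SteinMatrix.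
Context {R : realType} (N m l : nat) d (T : measurableType d).
Notation I := ('I_N * 'I_m * 'I_l)%type.
Variables (P : probability T R) (X : I -> {RV P >-> R}).
Hypothesis X_iid : iid_standard_normal X.
Variable (i0 : I).
Notation joint := (joint X).

Lemma mean_temperedD (f g : (I -> R) -> R) : tempered f -> tempered g ->
  (\int[P]_t (f (joint t) + g (joint t)) = \int[P]_t f (joint t) + \int[P]_t g (joint t))%R.
Proof. by move=> tf tg; apply: RintegralD => //; exact: integrable_tempered. Qed.

Lemma mean_temperedZ (a : R) (f : (I -> R) -> R) : tempered f ->
  (\int[P]_t (a * f (joint t)) = a * \int[P]_t f (joint t))%R.
Proof. by move=> tf; apply: RintegralZl => //; exact: integrable_tempered. Qed.

Lemma le_mean_tempered (f g : (I -> R) -> R) : tempered f -> tempered g ->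
  (forall w, f w <= g w) -> (\int[P]_t f (joint t) <= \int[P]_t g (joint t))%R.
Proof.
by move=> tf tg fg; apply: le_Rintegral => //; exact: integrable_tempered.
Qed.

Lemma mean_cst (a : R) : (\int[P]_t a = a)%R.
Proof. by rewrite /Rintegral integral_cst //= (probability_setT P) mule1. Qed.

Lemma mean_tempered_sum (J : Type) (r : seq J) (F : J -> (I -> R) -> R) :
  (forall j, tempered (F j)) ->
  (\int[P]_t (\sum_(j <- r) F j (joint t)) = \sum_(j <- r) \int[P]_t F j (joint t))%R.
Proof.
move=> tF; elim: r => [|j r IH].
  by under eq_Rintegral do rewrite big_nil; rewrite big_nil mean_cst.
under eq_Rintegral do rewrite big_cons.
have ts := tempered_sum r (Q := xpredT) (fun k _ => tF k).
by rewrite big_cons (mean_temperedD (tF j) ts) IH.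
Qed.

Variable (j : 'I_N).

Definition block (w : I -> R) : 'M[R]_(m, l) := \matrix_(a, b) w (j, a, b).

Lemma mderiv_block w a b x :
  mderiv (fun y => block (update w (j, a, b) y)) x (delta_mx a b).
Proof.
move=> a' b'; rewrite mxE.
rewrite (_ : (fun _ => _) =
  (fun y : R => if (a' == a) && (b' == b) then y else w (j, a', b'))).
  by case: ((a' == a) && (b' == b)); [exact: is_derive_id|exact: is_derive_cst].
by apply/funext => y; rewrite mxE /update !xpair_eqE eqxx.
Qed.

Lemma admissible_block : admissible block.
Proof.
split=> [a b|w i x a b].
  by apply: tempered_eq (tempered_coord (j, a, b)) => w; rewrite mxE.
rewrite (_ : (fun _ => _) = (fun y : R => if (j, a, b) == i then y else w (j, a, b))).
  by case: (_ == i); [exact: derivable_id|exact: derivable_cst].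
by apply/funext => y; rewrite mxE /update.
Qed.

(** The coordinate identities, summed over the entries of the block; the
    right-hand side is the expected divergence of [F]. *)
Lemma stein_matrix (F : (I -> R) -> 'M[R]_(m, l))
    (DF : 'I_m -> 'I_l -> (I -> R) -> 'M[R]_(m, l)) :
  admissible F -> (forall a b, admissible (DF a b)) ->
  (forall a b w x, mderiv (fun y => F (update w (j, a, b) y)) x
     (DF a b (update w (j, a, b) x))) ->
  (\int[P]_t \tr ((block (joint t))^T *m F (joint t)) =
   \int[P]_t \sum_a \sum_b DF a b (joint t) a b)%R.
Proof.
move=> nF nDF hD.
have tDF a : tempered (fun w => \sum_b DF a b w a b).
  by apply: tempered_sum => b _; have [] := nDF a b.
have txF a b : tempered (fun w : I -> R => w (j, a, b) * F w a b).
  by apply: temperedM; [exact: tempered_coord|have [] := nF].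
rewrite (mean_tempered_sum _ tDF).
under eq_Rintegral => t _.
  rewrite (_ : \tr _ = \sum_a \sum_b joint t (j, a, b) * F (joint t) a b); last first.
    rewrite exchange_big; apply: eq_bigr => b _; rewrite mxE.
    by apply: eq_bigr => a _; rewrite !mxE.
  over.
rewrite (@mean_tempered_sum _ _ (fun a w => \sum_b w (j, a, b) * F w a b)); last first.
  by move=> a; apply: tempered_sum => b _.
apply: eq_bigr => a _.
rewrite (@mean_tempered_sum _ _ (fun b w => w (j, a, b) * F w a b))//.
rewrite (@mean_tempered_sum _ _ (fun b w => DF a b w a b)); last first.
  by move=> b; have [] := nDF a b.
apply: eq_bigr => b _; congr fine.
apply: (@stein_identity _ _ _ _ _ _ X_iid (j, a, b) (fun w => F w a b)
  (fun w => DF a b w a b)).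
- by have [] := nF.
- by have [] := nDF a b.
- by move=> w x; exact: hD.
- move=> w x; apply: differentiable_continuous; apply/derivable1_diffP.
  by have [_] := nDF a b; apply.
Qed.

End SteinMatrix.

(** * Expected residual of a Gaussian sketch *)

Section OrthogonalDivergence.
Context {R : realFieldType} (m l : nat).
Variables (Pi s : 'M[R]_m) (k g L : 'M[R]_(m, l)).
Hypotheses (Pi_sym : Pi^T = Pi) (s_sym : s^T = s).
Hypotheses (Pi_k : Pi *m k = k) (Pi_L : Pi *m L = 0).

(** The derivative of [K = S *m G], where [G = Pi *m Om] and [S] is its
    resolvent, when [Om] moves along [delta_mx a b]; here [s], [k] and [g] stand
    for the values of [S], [K] and [G]. *)
Definition resolvent_diff a b : 'M[R]_(m, l) := s *m (Pi *m delta_mx a b) -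
  s *m (Pi *m delta_mx a b *m g^T + g *m (Pi *m delta_mx a b)^T) *m k.

Let LTPi : L^T *m Pi = 0. Proof. by rewrite -{1}Pi_sym -trmx_mul Pi_L trmx0. Qed.

Let trPi (Y : 'M[R]_(l, m)) : \tr (L *m Y *m Pi) = 0.
Proof. by rewrite mxtrace_mulC mulmxA Pi_L mul0mx mxtrace0. Qed.

Lemma sum_resolvent_diff : \sum_a \sum_b resolvent_diff a b a b =
  \tr (s *m Pi) * (l%:R - \tr (g^T *m k)) - \tr ((s *m g)^T *m k).
Proof.
have E a b : resolvent_diff a b = s *m Pi *m delta_mx a b *m 1%:M -
    (s *m Pi *m delta_mx a b *m (g^T *m k) +
     s *m g *m (delta_mx a b)^T *m k).
  rewrite /resolvent_diff trmx_mul Pi_sym mulmx1 mulmxDr mulmxDl !mulmxA.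
  by rewrite -[_ *m Pi *m k]mulmxA Pi_k.
under eq_bigr do under eq_bigr do rewrite E.
by rewrite sum_mxD sum_mxN sum_mxD !sum_delta sum_delta_tr mxtrace1; ring.
Qed.

(** In this sum and the next one, each term of the divergence is a trace in which,
    up to a cyclic permutation of the factors, [Pi] and [L] are adjacent. *)
Lemma sum_orthogonal_left :
  \sum_a \sum_b (L *m ((resolvent_diff a b)^T *m k)) a b = 0.
Proof.
have E a b : L *m ((resolvent_diff a b)^T *m k) =
   L *m (delta_mx a b)^T *m (Pi *m s *m k) -
   (L *m k^T *m g *m (delta_mx a b)^T *m (Pi *m s *m k) +
    L *m k^T *m Pi *m delta_mx a b *m (g^T *m s *m k)).
  rewrite /resolvent_diff linearB /= !trmx_mul linearD /= !trmx_mul !trmxK Pi_sym s_sym.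
  by rewrite !(mulmxBl, mulmxBr, mulmxDl, mulmxDr) !mulmxA.
under eq_bigr do under eq_bigr do rewrite E.
rewrite sum_mxD sum_mxN sum_mxD sum_delta !sum_delta_tr trPi mul0r.
rewrite !mulmxA LTPi !mul0mx mxtrace0 !trmx_mul !mulmxA -[_ *m L^T *m Pi]mulmxA LTPi.
by rewrite mulmx0 !mul0mx mxtrace0 addr0 subr0.
Qed.

Lemma sum_orthogonal_right :
  \sum_a \sum_b (L *m (k^T *m resolvent_diff a b)) a b = 0.
Proof.
have E a b : L *m (k^T *m resolvent_diff a b) =
   L *m (k^T *m s) *m Pi *m delta_mx a b *m 1%:M -
   (L *m (k^T *m s) *m Pi *m delta_mx a b *m (g^T *m k) +
    L *m k^T *m s *m g *m (delta_mx a b)^T *m (Pi *m k)).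
  rewrite /resolvent_diff trmx_mul Pi_sym mulmx1.
  by rewrite !(mulmxBl, mulmxBr, mulmxDl, mulmxDr, mulmxN) !mulmxA.
under eq_bigr do under eq_bigr do rewrite E.
rewrite sum_mxD sum_mxN sum_mxD !sum_delta !sum_delta_tr !trPi !mul0r.
rewrite !trmx_mul !mulmxA -[_ *m L^T *m Pi]mulmxA LTPi mulmx0 !mul0mx mxtrace0.
by rewrite addr0 subr0.
Qed.

End OrthogonalDivergence.

Section RangeFinder.
Context {R : realType} (N m l : nat) d (T : measurableType d).
Notation I := ('I_N * 'I_m * 'I_l)%type.
Variables (P : probability T R) (X : I -> {RV P >-> R}).
Hypothesis X_iid : iid_standard_normal X.
Variables (i0 : I) (j : 'I_N).
Notation joint := (joint X).
Variables (Pi : 'M[R]_m) (eps : R).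
Hypotheses (Pi_sym : Pi^T = Pi) (Pi_idem : Pi *m Pi = Pi) (eps_gt0 : 0 < eps).
Notation Om := (@block R N m l j).

Let G (w : I -> R) := Pi *m Om w.
Let S w := resolvent eps (G w).
Let K w := S w *m G w.

(** The transpose of the Tikhonov-regularized pseudo-inverse of [Pi *m Om]. *)
Definition ridge_pinv_tr (w : I -> R) : 'M[R]_(m, l) :=
  resolvent eps (Pi *m Om w) *m (Pi *m Om w).

Let Pi_G w : Pi *m G w = G w.
Proof. by rewrite mulmxA Pi_idem. Qed.

Let nG : admissible G.
Proof. by apply: admissibleM (admissible_block _ _ _); exact: admissible_cst. Qed.
Let nS : admissible S. Proof. exact: admissible_resolvent. Qed.
Let nK : admissible K. Proof. exact: admissibleM. Qed.

Let DK a b w := resolvent_diff Pi (S w) (K w) (G w) a b.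

Let mderiv_K a b w x : mderiv (fun y => K (update w (j, a, b) y)) x
  (DK a b (update w (j, a, b) x)).
Proof.
have dG : mderiv (fun y => G (update w (j, a, b) y)) x (Pi *m delta_mx a b).
  have := mderivM (mderiv_cst Pi x) (mderiv_block j w a b x).
  by move=> /mderiv_eq; apply; rewrite mul0mx add0r.
have dB := mderivD (mderivM dG (mderiv_tr dG)) (mderiv_cst (eps%:M : 'M[R]_m) x).
have dS := mderiv_inv (fun y => gram_unit eps_gt0 (G (update w (j, a, b) y))) dB.
have := mderivM dS dG => /mderiv_eq; apply.
by rewrite /= addr0 /DK /resolvent_diff addrC mulNmx !mulmxA.
Qed.

Let nDK a b : admissible (DK a b).
Proof.
have c A : admissible (fun=> A : 'M[R]_(m, l)) by exact: admissible_cst.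
apply: admissibleD; first by apply: admissibleM.
apply: admissibleN; apply: admissibleM => //; apply: admissibleM => //; apply: admissibleD.
  by apply: admissibleM => //; exact: admissible_tr.
by apply: admissibleM => //; exact: admissible_cst.
Qed.

Let PiK w : Pi *m K w = K w. Proof. exact: Pi_K. Qed.

Let div_K w : \sum_a \sum_b DK a b w a b =
  \tr (S w *m Pi) * (l%:R - \tr ((G w)^T *m K w)) - sqnorm (K w).
Proof.
rewrite (sum_resolvent_diff _ _ Pi_sym (PiK w)); congr (_ - _).
by rewrite mxtrace_mulC.
Qed.

Lemma tempered_tr_resolvent : tempered (fun w => \tr (S w *m Pi)).
Proof. by apply: tempered_mxtrace; apply: admissibleM => //; exact: admissible_cst. Qed.

(** In Stein's identity for [K], the inner product with the Gaussian block is
    [\tr ((G w)^T *m K w) <= \tr Pi <= k], while the divergence is at least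
    [(l - k - 1) * \tr (S w *m Pi)]. The limit case [eps = 0] is the formula for
    the mean of an inverse Wishart matrix. *)
Lemma expected_tr_resolvent (k : nat) : \tr Pi <= k%:R -> (k.+1 < l)%N ->
  (\int[P]_t \tr (S (joint t) *m Pi) <= k%:R / (l%:R - k%:R - 1))%R.
Proof.
move=> trk kl.
have h := stein_matrix X_iid i0 nK nDK mderiv_K.
have t1 := tempered_tr_resolvent.
have lk : 0 < l%:R - k%:R - 1 :> R.
  by rewrite -addrA -opprD subr_gt0 natr1 ltr_nat.
rewrite ler_pdivlMr// mulrC -(mean_temperedZ X_iid i0 _ t1).
have tk : 0 <= \tr Pi by rewrite -[X in \tr X]Pi_idem -{2}Pi_sym -/(sqnorm Pi) sqnorm_ge0.
apply: (@le_trans _ _ (\int[P]_t \sum_a \sum_b DK a b (joint t) a b)%R).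
  apply: (le_mean_tempered X_iid i0 (f := fun w => (l%:R - k%:R - 1) * \tr (S w *m Pi))
     (g := fun w => \sum_a \sum_b DK a b w a b)).
  - exact: temperedZ.
  - by apply: tempered_sum => a _; apply: tempered_sum => b _; have [] := nDK a b.
  move=> w; rewrite div_K.
  have := sqnorm_K_le eps_gt0 Pi_sym Pi_idem (Pi_G w).
  have := tr_resolvent_proj_ge0 eps_gt0 Pi_sym Pi_idem (Pi_G w).
  rewrite (tr_GTK eps_gt0 Pi_sym (Pi_G w)).
  rewrite -/(S w) -/(K w); set t := \tr (S w *m Pi); set q := sqnorm _ => t0 qt.
  have : 0 <= t * (k%:R - (\tr Pi - eps * t)).
    apply: mulr_ge0 => //; rewrite opprB addrCA addr_ge0 ?subr_ge0//.
    by rewrite mulr_ge0 // ltW.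
  lra.
rewrite -h; rewrite -[leRHS](mean_cst P).
apply: (le_mean_tempered X_iid i0 (f := fun w => \tr ((Om w)^T *m K w)) (g := fun=> k%:R)).
- apply: tempered_mxtrace; apply: admissibleM => //; apply: admissible_tr.
  exact: admissible_block.
- exact: tempered_cst.
move=> w; rewrite -PiK mulmxA -{1}Pi_sym -trmx_mul (tr_GTK eps_gt0 Pi_sym (Pi_G w)).
apply: le_trans trk; rewrite gerBl; apply: mulr_ge0; first exact: ltW.
exact: (tr_resolvent_proj_ge0 eps_gt0 Pi_sym Pi_idem (Pi_G w)).
Qed.

Section Residual.
Variables (n : nat) (C : 'M[R]_(n, m)).
Hypothesis CPi : C *m Pi = 0.

Let L w := C^T *m (C *m Om w).
Let PiCT : Pi *m C^T = 0.
Proof. by rewrite -{1}Pi_sym -trmx_mul CPi trmx0. Qed.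
Let PiL w : Pi *m L w = 0.
Proof. by rewrite mulmxA PiCT mul0mx. Qed.

Let nL : admissible L.
Proof.
apply: admissibleM; first exact: admissible_cst.
by apply: admissibleM; [exact: admissible_cst|exact: admissible_block].
Qed.

Let F w := L w *m ((K w)^T *m K w).
Let DF a b w : 'M[R]_(m, l) :=
  C^T *m C *m delta_mx a b *m ((K w)^T *m K w) +
  L w *m ((DK a b w)^T *m K w + (K w)^T *m DK a b w).

Let mderiv_F a b w x : mderiv (fun y => F (update w (j, a, b) y)) x
  (DF a b (update w (j, a, b) x)).
Proof.
have dL : mderiv (fun y => L (update w (j, a, b) y)) x (C^T *m C *m delta_mx a b).
  have := mderivM (mderiv_cst C^T x) (mderivM (mderiv_cst C x) (mderiv_block j w a b x)).
  by move=> /mderiv_eq; apply; rewrite !mul0mx !add0r mulmxA.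
have dK := @mderiv_K a b w x.
exact: mderivM dL (mderivM (mderiv_tr dK) dK).
Qed.

Let nDF a b : admissible (DF a b).
Proof.
have nKT := admissible_tr nK; have nDKT := admissible_tr (nDK a b).
apply: admissibleD.
  by apply: admissibleM; [exact: admissible_cst|exact: admissibleM].
by apply: admissibleM => //; apply: admissibleD; exact: admissibleM.
Qed.

(* The derivative of [K] contributes nothing: it acts through [Pi], and [L] is
   orthogonal to the range of [Pi]. *)
Let div_F w : \sum_a \sum_b DF a b w a b = sqnorm C * sqnorm (K w).
Proof.
rewrite /DF sum_mxD sum_delta.
have -> : \tr (C^T *m C) = sqnorm C by rewrite mxtrace_mulC.
have -> : \tr ((K w)^T *m K w) = sqnorm (K w) by rewrite mxtrace_mulC.
rewrite -[RHS]addr0; congr (_ + _).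
under eq_bigr do under eq_bigr do rewrite mulmxDr.
have sT : (S w)^T = S w by exact: resolvent_sym.
rewrite sum_mxD sum_orthogonal_left// sum_orthogonal_right// ?addr0//.
Qed.

(** [C *m Om] and [K], a function of [Pi *m Om], are independent, whence a
    factorization of the second moment. It is obtained here from Stein's
    identity for [L *m (K^T *m K)], where [K] behaves as a constant. *)
Lemma expected_residual :
  (\int[P]_t sqnorm (C *m Om (joint t) *m (K (joint t))^T) =
   sqnorm C * \int[P]_t sqnorm (K (joint t)))%R.
Proof.
have nF : admissible F.
  by apply: admissibleM => //; apply: admissibleM => //; exact: admissible_tr.
have h := stein_matrix X_iid i0 nF nDF mderiv_F.
rewrite -(mean_temperedZ X_iid i0 (sqnorm C) (f := fun w => sqnorm (K w))); last first.
  by apply: tempered_mxtrace; apply: admissibleM => //; exact: admissible_tr.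
under [RHS]eq_Rintegral do rewrite -div_F.
rewrite -h; apply: eq_Rintegral => t _; move: (joint t) => w.
rewrite /F /L; move: (Om w) (K w) => o k; rewrite /sqnorm !trmx_mul trmxK !mulmxA.
by rewrite -(mulmxA _ o^T C^T) mxtrace_mulC !mulmxA.
Qed.

End Residual.

(** The rows of [A - A *m Pi] are orthogonal to the range of [Pi], which contains
    those of the other part. *)
Lemma range_error_split (n : nat) (A : 'M[R]_(n, m)) w :
  sqnorm (A - A *m Om w *m (K w)^T) = sqnorm (A - A *m Pi) +
  sqnorm (eps *: (A *m (Pi *m S w)) - (A - A *m Pi) *m Om w *m (K w)^T).
Proof.
set C := A - A *m Pi; set D := eps *: _ - _.
have CPi : C *m Pi = 0 by rewrite mulmxBl -mulmxA Pi_idem subrr.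
have CK : C *m K w = 0 by rewrite -PiK mulmxA CPi mul0mx.
have sT : (S w)^T = S w by exact: resolvent_sym.
have -> : A - A *m Om w *m (K w)^T = C + D.
  have GK : G w *m (K w)^T = Pi - eps *: (Pi *m S w).
    rewrite trmx_mul sT mulmxA -{1}(Pi_G w) -[Pi *m G w *m _]mulmxA -mulmxA.
    rewrite mul_GGT_resolvent//.
    by rewrite mulmxBr mulmx1 -scalemxAr.
  have -> : A *m Om w *m (K w)^T = A *m (G w *m (K w)^T) + C *m Om w *m (K w)^T.
    by rewrite /C /G; move: (K w)^T => kt; rewrite !mulmxBl !mulmxA [RHS]addrC subrK.
  rewrite GK mulmxBr -scalemxAr /D /C; move: (C *m _ *m _) => Z.
  by rewrite opprD opprB !addrA [A + _ - _]addrAC.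
rewrite sqnormD (_ : C *m D^T = 0) ?mxtrace0 ?mulr0 ?addr0//.
have cS : Pi *m S w = S w *m Pi by exact: resolvent_comm.
rewrite /D; move: (K w) CK (S w) sT cS => k Ck s sT cS.
rewrite linearB linearZ /= !trmx_mul sT Pi_sym -cS trmxK mulmxBr -scalemxAr.
by rewrite !mulmxA CPi Ck !mul0mx scaler0 subrr.
Qed.

(** The bias and the sketched tail are not orthogonal; Young's inequality with a
    small [eta] keeps the factor of the tail close to 1, and the large factor
    [1 + eta^-1] falls on the bias, which carries [eps]. *)
Lemma expected_range_error (n : nat) (A : 'M[R]_(n, m)) (k : nat) (eta : R) :
  \tr Pi <= k%:R -> (k.+1 < l)%N -> 0 < eta ->
  (\int[P]_t sqnorm (A - A *m Om (joint t) *m (ridge_pinv_tr (joint t))^T) <=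
   sqnorm (A - A *m Pi) * (1 + (1 + eta) * (k%:R / (l%:R - k%:R - 1))) +
   (1 + eta^-1) * (eps * sqnorm A) * (k%:R / (l%:R - k%:R - 1)))%R.
Proof.
move=> trk kl eta0; set C := A - A *m Pi; set kap := k%:R / _.
have CPi : C *m Pi = 0 by rewrite mulmxBl -mulmxA Pi_idem subrr.
pose b1 := 1 + eta^-1; pose b2 := 1 + eta.
have b1p : 0 <= b1 by rewrite addr_ge0 ?invr_ge0 ?ltW.
have b2p : 0 <= b2 by rewrite addr_ge0 ?ltW.
have tq (p q : nat) (F : (I -> R) -> 'M[R]_(p, q)) :
    admissible F -> tempered (fun w => sqnorm (F w)).
  by move=> nF; apply: tempered_mxtrace; apply: admissibleM => //; exact: admissible_tr.
have nC q (B : 'M[R]_(q, m)) : admissible (fun w => B *m Om w *m (K w)^T).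
  apply: admissibleM; last exact: admissible_tr.
  by apply: admissibleM; [exact: admissible_cst|exact: admissible_block].
have tR := tq _ _ _ (nC _ C).
have tS := tempered_tr_resolvent.
pose f w := sqnorm C + (b1 * (eps * sqnorm A) * \tr (S w *m Pi) +
   b2 * sqnorm (C *m Om w *m (K w)^T)).
have tf1 := temperedZ (b1 * (eps * sqnorm A)) tS.
have tf2 := temperedZ b2 tR.
have tf12 := temperedD tf1 tf2.
have tf : tempered f by apply: temperedD tf12; exact: tempered_cst.
apply: (@le_trans _ _ (\int[P]_t f (joint t))%R).
  apply: (le_mean_tempered X_iid i0 (f := fun w => sqnorm (A - A *m Om w *m (K w)^T)) _ tf).
    apply: tq; apply: admissibleD; first exact: admissible_cst.
    exact: admissibleN.
  move=> w; rewrite range_error_split -/C /f lerD2l.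
  apply: le_trans (sqnormB_young _ _ eta0) _.
  rewrite -/b1 -/b2 lerD2r -[leRHS]mulrA ler_wpM2l//.
  rewrite sqnormZ expr2 -!mulrA ler_pM2l//.
  have h := sqnorm_resolvent_proj_le eps_gt0 Pi_sym Pi_idem (Pi_G w).
  apply: le_trans (ler_wpM2l (ltW eps_gt0) (sqnorm_mulmx _ _)) _.
  rewrite (resolvent_comm eps_gt0 Pi_sym (Pi_G w)) mulrCA.
  by rewrite ler_wpM2l ?sqnorm_ge0.
rewrite /f (mean_temperedD X_iid i0 (tempered_cst (sqnorm C)) tf12) mean_cst.
rewrite (mean_temperedD X_iid i0 tf1 tf2).
rewrite (mean_temperedZ X_iid i0 _ tS) (mean_temperedZ X_iid i0 _ tR).
have hS := expected_tr_resolvent trk kl.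
have hK : (\int[P]_t sqnorm (K (joint t)) <= kap)%R.
  apply: le_trans hS; apply: (le_mean_tempered X_iid i0 (f := fun w => sqnorm (K w)) _ tS).
    exact: tq.
  by move=> w; exact: (sqnorm_K_le eps_gt0 Pi_sym Pi_idem (Pi_G w)).
rewrite (expected_residual CPi) mulrDr mulr1 -addrA lerD2l [leLHS]addrC; apply: lerD.
  rewrite mulrCA; apply: ler_wpM2l; first exact: sqnorm_ge0.
  exact: ler_wpM2l.
apply: ler_wpM2l => //; apply: mulr_ge0 => //; apply: mulr_ge0; first exact: ltW.
exact: sqnorm_ge0.
Qed.

End RangeFinder.

(** * The spectral theorem for real symmetric matrices *)

Section SymmetricSpectral.
Context {R : rcfType}.

(** A complex eigenvalue of a real symmetric matrix is real: compare
    [v B v^*] with its conjugate. *)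
Lemma symmetric_eigenvalue n (B : 'M[R]_n.+1) : B^T = B ->
  exists a, eigenvalue B a.
Proof.
move=> Bsym; pose toC := real_complex R.
pose BC := map_mx toC B.
have [z /eigenvalueP[v vB v0]] := eigenvalue_closed BC (ltn0Sn n).
pose vs := map_mx Num.conj v^T.
have BCH : map_mx Num.conj BC^T = BC.
  apply/matrixP => i j; rewrite !mxE -[in RHS]Bsym mxE; exact: conjc_real.
have nv : v *m vs != 0.
  apply: contra_neq v0 => /matrixP /(_ 0 0); rewrite !mxE => /eqP.
  rewrite psumr_eq0 => [/allP h|i _]; last by rewrite !mxE mul_conjC_ge0.
  apply/rowP => i; rewrite mxE; have := h i (mem_index_enum _).
  by rewrite !mxE mul_conjC_eq0 => /eqP.
have e1 : v *m BC *m vs = z *: (v *m vs) by rewrite vB scalemxAl.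
have cc (u : 'M[R[i]]_1) : map_mx Num.conj u^T = map_mx Num.conj u.
  by apply/matrixP => i j; rewrite !ord1 !mxE.
have vsK : map_mx Num.conj vs^T = v.
  by apply/matrixP => i j; rewrite !mxE conjCK.
have e2 : map_mx Num.conj (v *m vs)^T = v *m vs.
  rewrite trmx_mul map_mxM vsK.
  by congr (_ *m _); apply/matrixP => i j; rewrite !mxE.
have e3 : map_mx Num.conj (v *m BC *m vs)^T = v *m BC *m vs.
  rewrite !trmx_mul !map_mxM BCH vsK mulmxA.
  by congr (_ *m _ *m _); apply/matrixP => i j; rewrite !mxE.
have zr : z^* = z.
  move: e3; rewrite e1 linearZ /= map_mxZ e2 => /eqP.
  rewrite -subr_eq0 -scalerBl scaler_eq0 (negPf nv) orbF subr_eq0 => /eqP.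
  by [].
have : z \is Num.real by apply/CrealP.
move=> /complex_realP [a za]; exists a.
have rz : root (map_poly toC (char_poly B)) z.
  by rewrite map_char_poly -eigenvalue_root_char; apply/eigenvalueP; exists v.
by move: rz; rewrite za eigenvalue_root_char (fmorph_root toC).
Qed.

(** The reflection exchanging [v] and the first axis. *)
Lemma householder n (v : 'rV[R]_n.+1) : v *m v^T = 1%:M ->
  exists2 H : 'M[R]_n.+1, H *m H^T = 1%:M & row 0 H = v.
Proof.
move=> v1; pose e : 'rV[R]_n.+1 := delta_mx 0 0; pose u := v - e.
have ee : e *m e^T = 1%:M.
  by rewrite trmx_delta mul_delta_mx; apply/matrixP => i j; rewrite !ord1 !mxE.
have eH (H : 'M[R]_n.+1) : e *m H = row 0 H by rewrite rowE.
have [u0|u0] := eqVneq u 0.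
  exists 1%:M; first by rewrite trmx1 mulmx1.
  by rewrite row1; apply/esym/eqP; rewrite -subr_eq0; exact/eqP.
pose s := (u *m u^T) 0 0.
have uu : u *m u^T = s%:M by rewrite [LHS]mx11_scalar.
have s0 : s != 0.
  apply: contra_neq u0 => s0; apply: sqnorm_eq0.
  by rewrite /sqnorm uu s0 raddf0 mxtrace0.
pose p := u^T *m u; pose H := 1%:M - (2 / s) *: p.
have HT : H^T = H by rewrite linearB linearZ /= trmx1 trmx_mul trmxK.
have pp : p *m p = s *: p.
  by rewrite mulmxA -(mulmxA u^T) uu mul_mx_scalar scalemxAl.
exists H.
  rewrite HT mulmxBl mul1mx !mulmxBr mulmx1 -!scalemxAl -!scalemxAr pp !scalerA.
  rewrite (_ : 2 / s * (2 / s) * s = 2 / s + 2 / s); last by field.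
  by rewrite scalerDl opprB addrK subrK.
rewrite -eH mulmxBr mulmx1 -scalemxAr mulmxA.
have euT : e *m u^T = (- (s / 2))%:M.
  have ev : e *m v^T = (v 0 0)%:M.
    by rewrite -rowE [LHS]mx11_scalar !mxE.
  have ve : v *m e^T = (v 0 0)%:M by rewrite -[LHS]trmxK trmx_mul trmxK ev tr_scalar_mx.
  have h : s = 2 - 2 * v 0 0.
    have := congr1 (fun A : 'M[R]_1 => A 0 0) uu; rewrite [in RHS]mxE eqxx mulr1n => <-.
    rewrite /u linearB /= mulmxBl !mulmxBr v1 ee ev ve !mxE /=; ring.
  rewrite /u linearB /= mulmxBr ev ee h; apply/matrixP => i k.
  by rewrite !ord1 !mxE /=; field.
rewrite euT mul_scalar_mx scalerA (_ : _ * _ = -1); last by field.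
by rewrite scaleN1r opprK addrC subrK.
Qed.

(** Deflation: once an eigenvector is the first axis, symmetry splits off the
    first row and the first column together. *)
Theorem symmetric_spectral n (B : 'M[R]_n) : B^T = B ->
  exists U : 'M[R]_n, exists2 D : 'rV[R]_n, U *m U^T = 1%:M & U *m B *m U^T = diag_mx D.
Proof.
elim: n B => [|n IH] B Bsym.
  by exists 1%:M, 0; [rewrite trmx1 mulmx1|apply/matrixP => -[]].
have [a /eigenvalueP[w wB w0]] := symmetric_eigenvalue Bsym.
have wpos : 0 < sqnorm w.
  by rewrite lt_def sqnorm_ge0 andbT; apply: contra_neq w0; exact: sqnorm_eq0.
pose v := (Num.sqrt (sqnorm w))^-1 *: w.
have v1 : v *m v^T = 1%:M.
  rewrite linearZ /= -scalemxAl -scalemxAr scalerA -expr2 exprVn sqr_sqrtr ?sqnorm_ge0//.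
  rewrite [w *m w^T]mx11_scalar -trace_mx11 -/(sqnorm w) scale_scalar_mx mulVf//.
  by rewrite gt_eqF.
have vB : v *m B = a *: v by rewrite -scalemxAl wB scalerA mulrC -scalerA.
have [H HHT Hv] := householder v1.
have HTH : H^T *m H = 1%:M by exact: mulmx1C.
have [B1 B1E] : exists B1, H *m B *m H^T = B1 by eexists.
have B1sym : B1^T = B1 by rewrite -B1E !trmx_mul trmxK Bsym mulmxA.
have B1row : row 0 B1 = a *: delta_mx 0 0.
  by rewrite -B1E !row_mul Hv vB -scalemxAl -Hv -row_mul HHT row1.
pose B2 : 'M[R]_(1 + n) := B1.
have B2E : B2 = block_mx a%:M 0 0 (drsubmx B2).
  rewrite -[LHS]submxK; congr block_mx.
  - apply/matrixP => i j; rewrite !ord1 !mxE.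
    have := congr1 (fun r : 'rV[R]_n.+1 => r 0 0) B1row; rewrite !mxE eqxx mulr1 => <-.
    by rewrite /B2; congr (B1 _ _); apply/val_inj.
  - apply/matrixP => i j; rewrite !ord1 !mxE.
    have := congr1 (fun r : 'rV[R]_n.+1 => r 0 (rshift 1 j)) B1row.
    rewrite !mxE /= mulr0 => <-.
    by rewrite /B2; congr (B1 _ _); apply/val_inj.
  - apply/matrixP => i j; rewrite !ord1 !mxE.
    have := congr1 (fun r : 'rV[R]_n.+1 => r 0 (rshift 1 i)) B1row.
    rewrite !mxE /= mulr0 => <-.
    by rewrite -[in RHS]B1sym mxE /B2; congr (B1 _ _); apply/val_inj.
have [|U [D UU UD]] := IH (drsubmx B2).
  apply/matrixP => i1 i2; rewrite !mxE.
  by have := congr1 (fun M : 'M[R]_n.+1 => M (rshift 1 i1) (rshift 1 i2)) B1sym; rewrite mxE.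
pose V : 'M[R]_(1 + n) := block_mx 1%:M 0 0 U.
have VT : V^T = block_mx 1%:M 0 0 U^T by rewrite tr_block_mx trmx1 !trmx0.
have VV : V *m V^T = 1%:M.
  rewrite VT /V mulmx_block !(mul0mx, mulmx0, mul1mx, addr0, add0r) UU.
  by rewrite -scalar_mx_block.
have VBV : V *m B2 *m V^T = diag_mx (row_mx a%:M D).
  rewrite B2E VT /V !mulmx_block !(mul0mx, mulmx0, mul1mx, mulmx1, addr0, add0r) UD.
  rewrite diag_mx_row; congr block_mx; apply/matrixP => i j.
  by rewrite !ord1 !mxE eqxx.
exists (V *m H); exists (row_mx a%:M D).
  by rewrite trmx_mul mulmxA -(mulmxA V) HHT mulmx1; exact: VV.
by rewrite trmx_mul !mulmxA -(mulmxA V) -(mulmxA V) B1E; exact: VBV.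
Qed.

End SymmetricSpectral.

(** * Singular values and leading singular vectors *)

Section SingularValues.
Context {R : realType}.

Lemma char_poly_orthogonal n (U B : 'M[R]_n) : U *m U^T = 1%:M ->
  char_poly (U *m B *m U^T) = char_poly B.
Proof.
move=> UU; pose L := map_mx (@polyC R).
have LL : L _ _ U *m L _ _ U^T = 1%:M by rewrite -map_mxM UU map_mx1.
have e : char_poly_mx (U *m B *m U^T) = L _ _ U *m char_poly_mx B *m L _ _ U^T.
  rewrite /char_poly_mx mulmxBr mulmxBl scalar_mxC.
  rewrite -[_%:M *m _ *m _]mulmxA LL mulmx1 -/(L _ _).
  by rewrite /L !map_mxM.
rewrite /char_poly e !det_mulmx mulrAC -det_mulmx LL det1 mul1r//.
Qed.

(** The characteristic polynomial of [A *m A^T] is the product of the factors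
    ['X - D i], so that the multiplicity of a root counts the occurrences of its
    value in [D]. *)
Lemma gram_spectrum_perm m q (A : 'M[R]_(m, q)) (U : 'M[R]_m) (D : 'rV[R]_m) :
  U *m U^T = 1%:M -> U *m (A *m A^T) *m U^T = diag_mx D ->
  perm_eq (gram_spectrum A) [seq D 0 i | i <- enum 'I_m].
Proof.
move=> UU UD; apply/allP => x _ /=; apply/eqP.
have chiE : char_poly (A *m A^T) = \prod_(i <- enum 'I_m) ('X - (D 0 i)%:P).
  rewrite -(char_poly_orthogonal _ UU) UD char_poly_trig ?diag_mx_is_trig// big_enum.
  by apply: eq_bigr => i _; rewrite mxE eqxx.
set chi := char_poly _ in chiE *.
have chi0 : chi != 0 by rewrite monic_neq0// char_poly_monic.
rewrite /gram_spectrum -/chi count_flatten -map_comp.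
transitivity (mup x chi).
  rewrite sumnE big_map.
  transitivity (\sum_(y <- rootsR chi | y == x) mup x chi)%N.
    rewrite [RHS]big_mkcond; apply: eq_bigr => y _ /=.
    by rewrite count_nseq /=; case: eqVneq => [->|_]; rewrite ?mul1n ?mul0n.
  case: (boolP (x \in rootsR chi)) => xr.
    by rewrite -big_filter filter_pred1_uniq ?uniq_roots// big_seq1.
  rewrite big_hasC; last by rewrite has_pred1.
  apply/esym/mupNroot; apply: contra xr => rx.
  have := roots_on_rootsR chi0 x; rewrite rx andbT => <-.
  by rewrite in_itv.
rewrite chiE; elim: (enum _) => [|i s IH].
  by rewrite big_nil (mupNroot (root1 _)).
rewrite big_cons mupM ?polyXsubC_eq0 ?monic_neq0 ?monic_prod_XsubC//.
by rewrite IH -['X - _]expr1 mup_XsubCX.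
Qed.

Lemma perm_map_enum (n : nat) (i0 : 'I_n) (f : 'I_n -> R) (t : seq R) :
  perm_eq t [seq f i | i <- enum 'I_n] ->
  exists2 s, perm_eq s (enum 'I_n) & t = [seq f i | i <- s].
Proof.
move=> /(perm_iotaP 0) [Is]; rewrite size_map size_enum_ord => pI ->.
exists [seq nth i0 (enum 'I_n) k | k <- Is].
  have := perm_map (nth i0 (enum 'I_n)) pI.
  by rewrite map_nth_iota0 ?size_enum_ord// take_oversize ?size_enum_ord.
rewrite -map_comp; apply/eq_in_map => k kI /=.
rewrite (nth_map i0)// size_enum_ord.
by have := perm_mem pI k; rewrite kI mem_iota add0n => /esym.
Qed.

(** [Pi] projects onto the span of [k] leading right singular vectors: the rows
    [b i] of [U *m A] are orthogonal, of squared norms [D i]. *)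
Theorem leading_projector n m (A : 'M[R]_(n, m)) (k : nat) : (0 < n)%N ->
  exists Pi : 'M[R]_m, [/\ Pi^T = Pi, Pi *m Pi = Pi, \tr Pi <= k%:R &
    sqnorm (A - A *m Pi) <= \sum_(k <= i < n) singular_value A i ^+ 2].
Proof.
case: n A => // n A _.
have [|U [D UU UD]] := @symmetric_spectral R _ (A *m A^T).
  by rewrite trmx_mul trmxK.
have UTU : U^T *m U = 1%:M by exact: mulmx1C.
pose b i := row i (U *m A).
have bb i j : b i *m (b j)^T = (D 0 i *+ (i == j))%:M.
  have := congr1 (fun M : 'M[R]_n.+1 => M i j) UD.
  rewrite [in RHS]mxE => <-; rewrite [LHS]mx11_scalar; congr (_%:M).
  have -> : U *m (A *m A^T) *m U^T = (U *m A) *m (U *m A)^T by rewrite trmx_mul !mulmxA.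
  rewrite /b; move: (U *m A) => X; rewrite [LHS]mxE [RHS]mxE; apply: eq_bigr => k0 _.
  by rewrite !mxE.
have sb i : sqnorm (b i) = D 0 i by rewrite /sqnorm bb eqxx trace_mx11 mxE eqxx.
have D0 i : 0 <= D 0 i by rewrite -sb sqnorm_ge0.
have pe : perm_eq (rev (gram_spectrum A)) [seq D 0 i | i <- enum 'I_n.+1].
  by rewrite perm_rev; exact: gram_spectrum_perm UU UD.
have [s ps specE] := perm_map_enum ord0 pe.
have us : uniq s by rewrite (perm_uniq ps) enum_uniq.
have utk : uniq (take k s) by rewrite take_uniq.
have szs : size s = n.+1 by rewrite (perm_size ps) size_enum_ord.
(* The inverse of 0 being 0, a row [b i = 0] contributes nothing. *)
pose Pi : 'M[R]_m := \sum_(i <- take k s) (D 0 i)^-1 *: ((b i)^T *m b i).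
have bPi j : b j *m Pi = if j \in take k s then b j else 0.
  rewrite mulmx_sumr.
  under eq_bigr do rewrite -scalemxAr mulmxA bb mul_scalar_mx scalerA.
  case: ifP => jk.
    rewrite (bigD1_seq j)//= big1 ?addr0 => [|i ij]; last first.
      by rewrite eq_sym (negPf ij) mulr0n mulr0 scale0r.
    rewrite eqxx mulr1n; have [d0|d0] := eqVneq (D 0 j) 0.
      by rewrite (@sqnorm_eq0 _ _ _ (b j)) ?scaler0// sb.
    by rewrite mulVf// scale1r.
  rewrite big_seq big1// => i ik; rewrite (_ : j == i = false) ?mulr0n ?mulr0 ?scale0r//.
  by apply: contraFF jk => /eqP ->.
exists Pi; split.
- rewrite linear_sum; apply: eq_bigr => i _.
  by rewrite linearZ /= trmx_mul trmxK.
- rewrite {1}/Pi mulmx_suml /Pi big_seq [RHS]big_seq; apply: eq_bigr => i ik.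
  by rewrite -/Pi -scalemxAl -mulmxA bPi ik.
- rewrite /Pi raddf_sum /=; apply: (@le_trans _ _ (\sum_(i <- take k s) 1)).
    apply: ler_sum => i _; rewrite mxtraceZ mxtrace_mulC -/(sqnorm (b i)) sb.
    by have [->|d0] := eqVneq (D 0 i) 0; rewrite ?mulr0 ?ler01// mulVf.
  rewrite big_const_seq count_predT iter_addr_0 ler_nat size_take.
  by case: ltnP.
rewrite -(sqnorm_isometry _ UTU) sqnorm_rows.
have rE i : row i (U *m (A - A *m Pi)) = if i \in take k s then 0 else b i.
  rewrite mulmxBr mulmxA linearB /= (row_mul i (U *m A)) -/(b i) bPi.
  by case: ifP; rewrite ?subrr ?subr0.
under eq_bigr do rewrite rE.
rewrite -big_enum -(perm_big _ ps) /= -{1}(cat_take_drop k s) big_cat /=.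
rewrite big_seq big1 ?add0r => [|i ->]; last by rewrite /sqnorm mul0mx mxtrace0.
have -> : \sum_(i <- drop k s) sqnorm (if i \in take k s then 0 else b i) =
          \sum_(i <- drop k s) D 0 i.
  rewrite big_seq [RHS]big_seq; apply: eq_bigr => i ik.
  have := us; rewrite -{1}(cat_take_drop k s) cat_uniq => /and3P[_ /hasPn /(_ i ik) h _].
  by rewrite (negPf h) sb.
rewrite (big_nth ord0) size_drop szs.
rewrite [leRHS](_ : _ = \sum_(0 + k <= i < n.+1) singular_value A i ^+ 2)%R// big_addn.
rewrite big_seq [leRHS]big_seq; apply: ler_sum => i; rewrite mem_index_iota => /andP[_ ik].
rewrite /singular_value sqr_sqrtr; last first.
  rewrite specE; have [iz|iz] := ltnP (i + k) (size s).
    by rewrite (nth_map ord0).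
  by rewrite nth_default ?size_map.
rewrite specE (nth_map ord0) ?szs; last by rewrite addnC -ltn_subRL.
by rewrite nth_drop [(k + i)%N]addnC.
Qed.

End SingularValues.

(** * Unfoldings and Tucker products *)

Section Fibers.
Context {R : realType} {N n : nat}.
Implicit Types (X Y : tensor R N n) (j : 'I_N).

Definition fiber_of j (i : {ffun 'I_N -> 'I_n}) : 'I_n * {ffun 'I_N.-1 -> 'I_n} :=
  (i j, [ffun k => i (lift j k)]).

Lemma fiber_index_diag j a (c : {ffun 'I_N.-1 -> 'I_n}) : fiber_index j a c j = a.
Proof. by rewrite ffunE unlift_none. Qed.

Lemma fiber_index_lift j a (c : {ffun 'I_N.-1 -> 'I_n}) k :
  fiber_index j a c (lift j k) = c k.
Proof. by rewrite ffunE liftK. Qed.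

Lemma fiber_indexK j : cancel (fun ac => fiber_index j ac.1 ac.2) (fiber_of j).
Proof.
move=> [a c]; rewrite /fiber_of /= fiber_index_diag; congr pair.
by apply/ffunP => k; rewrite ffunE fiber_index_lift.
Qed.

Lemma fiber_ofK j : cancel (fiber_of j) (fun ac => fiber_index j ac.1 ac.2).
Proof.
move=> i; apply/ffunP => k; rewrite /= ffunE.
by case: unliftP => [k' ->|->] //; rewrite ffunE.
Qed.

Lemma sum_fibers j (F : {ffun 'I_N -> 'I_n} -> R) :
  \sum_i F i = \sum_a \sum_c F (fiber_index j a c).
Proof.
rewrite pair_big /= (reindex (fun ac => fiber_index j ac.1 ac.2)) //=.
by exists (fiber_of j) => i _; [exact: fiber_indexK|exact: fiber_ofK].
Qed.

Definition fiber_col (c : {ffun 'I_N.-1 -> 'I_n}) : 'I_(n ^ N.-1) :=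
  cast_ord (card_fibers N n) (enum_rank c).

Lemma unfoldE j X a c : unfold j X a (fiber_col c) = X (fiber_index j a c).
Proof. by rewrite mxE /fiber_col cast_ordK enum_rankK. Qed.

Lemma fiber_col_bij : bijective fiber_col.
Proof.
exists (fun c => enum_val (cast_ord (esym (card_fibers N n)) c)) => c.
  by rewrite /fiber_col cast_ordK enum_rankK.
by rewrite /fiber_col enum_valK cast_ordKV.
Qed.

Lemma sum_fiber_col (F : 'I_(n ^ N.-1) -> R) : \sum_c F c = \sum_c F (fiber_col c).
Proof. by apply: reindex; exact: onW_bij fiber_col_bij. Qed.

Lemma sqnorm_unfold j X : sqnorm (unfold j X) = \sum_i X i ^+ 2.
Proof.
rewrite sqnormE (sum_fibers j); apply: eq_bigr => a _.
by rewrite sum_fiber_col; apply: eq_bigr => c _; rewrite unfoldE.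
Qed.

Lemma frobenius_unfold j X : frobenius X = Num.sqrt (sqnorm (unfold j X)).
Proof. by rewrite sqnorm_unfold. Qed.

Lemma unfold_inj j : injective (@unfold R N n j).
Proof.
move=> X Y XY; apply/ffunP => i; rewrite -(fiber_ofK j i) /=.
by rewrite -!unfoldE XY.
Qed.

Lemma unfoldD j X Y : unfold j (X + Y) = unfold j X + unfold j Y.
Proof. by apply/matrixP => a c; rewrite !mxE ffunE. Qed.

Lemma unfoldB j X Y : unfold j (X - Y) = unfold j X - unfold j Y.
Proof. by apply/matrixP => a c; rewrite !mxE !ffunE. Qed.

End Fibers.

Section Tucker.
Context {R : realType} {N : nat}.

Lemma tucker_comp (l m n : nat) (G : tensor R N l) (A : 'I_N -> 'M[R]_(m, l))
    (B : 'I_N -> 'M[R]_(n, m)) :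
  tucker (tucker G A) B = tucker G (fun k => B k *m A k).
Proof.
apply/ffunP => a; rewrite !ffunE.
under eq_bigr do rewrite ffunE mulr_suml.
rewrite exchange_big; apply: eq_bigr => h _ /=.
under eq_bigr do rewrite -mulrA.
rewrite -mulr_sumr; congr (_ * _).
under [RHS]eq_bigr do rewrite mxE.
rewrite bigA_distr_bigA; apply: eq_bigr => i _.
by rewrite -big_split; apply: eq_bigr => k _; rewrite mulrC.
Qed.

Lemma prod_delta (n : nat) (a i : {ffun 'I_N -> 'I_n}) :
  \prod_k (a k == i k)%:R = (a == i)%:R :> R.
Proof.
have [->|ai] := eqVneq a i; first by rewrite big1// => k _; rewrite eqxx.
have [k ak] : exists k, a k != i k.
  apply/existsP; apply: contraNT ai; rewrite negb_exists => /forallP h.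
  by apply/eqP/ffunP => k; apply/eqP; have := h k; rewrite negbK.
by rewrite (bigD1 k)//= (negPf ak) mul0r.
Qed.

Lemma subtensor_tucker (n l : nat) (X : tensor R N n) (J : 'I_N -> 'I_l -> 'I_n) :
  subtensor X J = tucker X (fun k => rowsub (J k) 1%:M).
Proof.
apply/ffunP => a; rewrite !ffunE; set b := [ffun k => _].
rewrite (bigD1 b)//= [X in _ + X]big1 ?addr0 => [|i ib]; last first.
  have -> : \prod_k rowsub (J k) 1%:M (a k) (i k) = (b == i)%:R :> R.
    by rewrite -prod_delta; apply: eq_bigr => k _; rewrite !mxE ffunE.
  by rewrite eq_sym (negPf ib) mulr0.
rewrite big1 ?mulr1// => k _; by rewrite !mxE ffunE eqxx.
Qed.

Lemma tucker_id (n : nat) (X : tensor R N n) : tucker X (fun=> 1%:M) = X.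
Proof.
apply/ffunP => a; rewrite !ffunE (bigD1 a)//= [X in _ + X]big1 ?addr0 => [|i ia].
  by rewrite big1 ?mulr1// => k _; rewrite mxE eqxx.
have -> : \prod_k (1%:M : 'M[R]_n) (a k) (i k) = (a == i)%:R.
  by rewrite -prod_delta; apply: eq_bigr => k _; rewrite mxE.
by rewrite eq_sym (negPf ia) mulr0.
Qed.

Lemma tuckerB (n l : nat) (X Y : tensor R N l) (A : 'I_N -> 'M[R]_(n, l)) :
  tucker (X - Y) A = tucker X A - tucker Y A.
Proof.
apply/ffunP => a; rewrite !ffunE -sumrN -big_split; apply: eq_bigr => i _ /=.
by rewrite !ffunE mulrBl.
Qed.

Lemma eq_tucker (n l : nat) (X : tensor R N l) (A B : 'I_N -> 'M[R]_(n, l)) :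
  A =1 B -> tucker X A = tucker X B.
Proof. by move=> AB; congr tucker; exact/funext. Qed.

Variable n : nat.
Implicit Types (X : tensor R N n) (j : 'I_N) (B : 'M[R]_n).

Definition mode_prod j B X : tensor R N n :=
  tucker X (fun k => if k == j then B else 1%:M).

Lemma unfold_mode_prod j B X : unfold j (mode_prod j B X) = B *m unfold j X.
Proof.
apply/matrixP => a c; have [f _ fK] := @fiber_col_bij N n.
rewrite -[c]fK; move: (f c) => {}c; rewrite unfoldE ffunE (sum_fibers j) mxE.
apply: eq_bigr => x _; rewrite (bigD1 c)//= [X in _ + X]big1 ?addr0 => [|i ic].
  rewrite unfoldE mulrC; congr (_ * _); rewrite (bigD1 j)//= eqxx !fiber_index_diag.
  rewrite big1 ?mulr1// => k kj; rewrite (negPf kj) mxE.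
  by have [k' ->|kj'] := unliftP j k; [rewrite !fiber_index_lift eqxx|rewrite kj' eqxx in kj].
have [k ck] : exists k, c k != i k.
  apply/existsP; apply: contraNT ic; rewrite negb_exists => /forallP h.
  by apply/eqP/ffunP => k; apply/esym/eqP; have := h k; rewrite negbK.
rewrite (bigD1 (lift j k))//= eq_sym (negPf (neq_lift _ _)) mxE !fiber_index_lift.
by rewrite (negPf ck) mul0r mulr0.
Qed.

Lemma mode_prodB j B X : X - mode_prod j B X = mode_prod j (1%:M - B) X.
Proof.
apply: (@unfold_inj _ _ _ j); rewrite unfoldB !unfold_mode_prod.
by rewrite mulmxBl mul1mx.
Qed.

(** A bound [g] on the square of the spectral norm of [B], stated through the
    action on matrices because [B] is to be applied to unfoldings. *)
Definition sqr_opnorm_le (g : R) B :=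
  forall q (Z : 'M[R]_(n, q)), sqnorm (B *m Z) <= g * sqnorm Z.

(** One mode at a time, as each mode product multiplies an unfolding by a matrix. *)
Lemma sqnorm_tucker_le (j0 : 'I_N) (g : R) (B : 'I_N -> 'M[R]_n) (r : seq 'I_N) X :
  0 <= g -> (forall k, sqr_opnorm_le g (B k)) -> uniq r ->
  sqnorm (unfold j0 (tucker X (fun k => if k \in r then B k else 1%:M))) <=
  g ^+ size r * sqnorm (unfold j0 X).
Proof.
move=> g0 bB; elim: r => [|j r IH] /=.
  by move=> _; rewrite (_ : tucker _ _ = X) ?mul1r//; exact: tucker_id.
move=> /andP[jr ur].
have -> : tucker X (fun k => if k \in j :: r then B k else 1%:M) =
  mode_prod j (B j) (tucker X (fun k => if k \in r then B k else 1%:M)).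
  rewrite /mode_prod tucker_comp; apply: eq_tucker => k; rewrite inE.
  by have [->|kj] := eqVneq k j; rewrite /= ?(negPf jr) ?mulmx1 ?mul1mx.
rewrite sqnorm_unfold -(sqnorm_unfold j) unfold_mode_prod.
apply: le_trans (bB j _ _) _; rewrite sqnorm_unfold -(sqnorm_unfold j0).
by rewrite exprS -mulrA ler_wpM2l// IH.
Qed.

(** Replacing the identity by [B k] in one mode at a time splits the error of a
    Tucker product into one term for each mode. *)
Lemma tucker_telescope (B : 'I_N -> 'M[R]_n) X :
  X - tucker X B = \sum_(j < N)
    tucker (mode_prod j (1%:M - B j) X) (fun k => if (k < j)%N then B k else 1%:M).
Proof.
pose E i := tucker X (fun k : 'I_N => if (k < i)%N then B k else 1%:M).
have E0 : E 0%N = X by exact: tucker_id.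
have EN : E N = tucker X B by apply: eq_tucker => k; rewrite ltn_ord.
have -> : X - tucker X B = \sum_(0 <= i < N) (E i - E i.+1).
  under eq_bigr => i _ do rewrite -[E i]opprK addrC.
  by rewrite (telescope_sumr (fun i => - E i))// E0 EN opprK addrC.
rewrite big_mkord; apply: eq_bigr => j _.
rewrite -mode_prodB tuckerB; congr (_ - _).
rewrite /mode_prod tucker_comp; apply: eq_tucker => k.
have [->|kj] := eqVneq k j; first by rewrite ltnn ltnSn mul1mx.
by rewrite mulmx1 ltnS leq_eqVlt (inj_eq val_inj) (negPf kj).
Qed.

End Tucker.

Lemma frobenius_sum (R : realType) (N n : nat) (j0 : 'I_N) (J : Type) (r : seq J)
    (F : J -> tensor R N n) :
  frobenius (\sum_(j <- r) F j) <= \sum_(j <- r) frobenius (F j).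
Proof.
elim: r => [|j r IH].
  rewrite !big_nil (frobenius_unfold j0) (_ : unfold j0 0 = 0).
    by rewrite /sqnorm mul0mx mxtrace0 sqrtr0.
  by apply/matrixP => a c; rewrite !mxE ffunE.
rewrite !big_cons; apply: (@le_trans _ _ (frobenius (F j) + frobenius (\sum_(j <- r) F j))).
  by rewrite !(frobenius_unfold j0) unfoldD sqrt_sqnormD.
by rewrite lerD2l.
Qed.

(** * Interpolatory projectors *)

Section InterpolatoryFactor.
Context {R : realType} (n l : nat).
Hypothesis le_ln : (l <= n)%N.
Variables (Q : 'M[R]_(n, l)) (s : 'S_n) (Z R11 : 'M[R]_l) (R12 : 'M[R]_(l, n - l)).
Hypothesis rrqr : strong_RRQR 2 le_ln Q^T s Z R11 R12.

Let J (k : 'I_l) : 'I_n := s (widen_ord le_ln k).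
Let J' (k : 'I_(n - l)) : 'I_n := s (cast_ord (subnKC le_ln) (rshift l k)).
Let W : 'M[R]_(n - l, l) := (invmx R11 *m R12)^T.

Definition interp_factor : 'M[R]_(n, l) := Q *m invmx (rowsub J Q).
Definition interp_proj : 'M[R]_n := interp_factor *m rowsub J 1%:M.

Let growth : R := 1 + 4 * l%:R * (n%:R - l%:R).

Let entryE i (k : 'I_(l + (n - l))) :
  Q (s (cast_ord (subnKC le_ln) k)) i = (Z *m row_mx R11 R12) i k.
Proof.
have [h _ _ _ _] := rrqr.
have := congr1 (fun M : 'M[R]_(l, n) => M i (cast_ord (subnKC le_ln) k)) h.
rewrite /col_perm !mxE => ->.
by apply: eq_bigr => x _; rewrite castmxE /= !cast_ordK cast_ord_id.
Qed.

Let top : rowsub J Q = (Z *m R11)^T.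
Proof.
apply/matrixP => k i; rewrite [LHS]mxE [RHS]mxE.
have -> : J k = s (cast_ord (subnKC le_ln) (lshift (n - l) k)) by congr (s _); exact/val_inj.
by rewrite entryE mul_mx_row row_mxEl.
Qed.

Let bottom : rowsub J' Q = (Z *m R12)^T.
Proof.
apply/matrixP => k i; rewrite [LHS]mxE [RHS]mxE.
by rewrite entryE mul_mx_row row_mxEr.
Qed.

Let top_unit : rowsub J Q \in unitmx.
Proof.
have [_ hZ _ hR _] := rrqr.
by rewrite top unitmx_tr unitmx_mul hR andbT; have [] := mulmx1_unit hZ.
Qed.

Let sqnorm_split q (Y : 'M[R]_(n, q)) :
  sqnorm Y = sqnorm (rowsub J Y) + sqnorm (rowsub J' Y).
Proof.
rewrite !sqnorm_rows.
have hs : bijective (fun k : 'I_(l + (n - l)) => s (cast_ord (subnKC le_ln) k)).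
  exists (fun i => cast_ord (esym (subnKC le_ln)) (s^-1%g i)) => i /=.
    by rewrite permK cast_ordK.
  by rewrite cast_ordKV permKV.
rewrite (reindex _ (onW_bij _ hs)) big_split_ord /=; congr (_ + _); apply: eq_bigr => k _.
  congr sqnorm; apply/rowP => c; rewrite !mxE; congr (Y _ _); congr (s _); exact/val_inj.
by congr sqnorm; apply/rowP => c; rewrite !mxE.
Qed.

(* In the order of rows given by [s], the factor is [col_mx 1%:M W]. *)
Let factor_top : rowsub J interp_factor = 1%:M.
Proof. by rewrite /interp_factor -mul_rowsub_mx mulmxV. Qed.

Let factor_bottom : rowsub J' interp_factor = W.
Proof.
have [_ hZ _ hR _] := rrqr.
rewrite /interp_factor -mul_rowsub_mx bottom top.
have uZ : Z \in unitmx by have [] := mulmx1_unit hZ.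
apply: (canLR (mulmxK _)); first by rewrite unitmx_tr unitmx_mul uZ.
by rewrite /W -trmx_mul -mulmxA mulKVmx.
Qed.

Let sqnorm_W : sqnorm W <= 4 * l%:R * (n%:R - l%:R).
Proof.
have [_ _ _ _ hW] := rrqr.
rewrite sqnorm_tr sqnormE; apply: (@le_trans _ _ (\sum_(i < l) \sum_(j < n - l) 4)).
  do 2 apply: ler_sum => ? _.
  rewrite -real_normK ?num_real// (_ : 4 = 2 ^+ 2); last by ring.
  by apply: lerXn2r; rewrite ?nnegrE.
rewrite !sumr_const !card_ord -natrB//.
by rewrite -[_ *+ l]mulr_natr -[_ *+ (n - l)]mulr_natr mulrAC.
Qed.

(** In the same order of rows, the projector maps [(x1, x2)] to [(x1, W x1)]. *)
Lemma interp_proj_opnorm : sqr_opnorm_le growth interp_proj.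
Proof.
move=> q Y; rewrite /interp_proj -mulmxA mul_rowsub_mx mul1mx.
rewrite sqnorm_split -(mul_rowsub_mx J) -(mul_rowsub_mx J') factor_top factor_bottom mul1mx.
have := sqnorm_mulmx W (rowsub J Y); have := sqnorm_split Y.
have := ler_wpM2r (sqnorm_ge0 (rowsub J Y)) sqnorm_W.
have := mulr_ge0 (le_trans (sqnorm_ge0 W) sqnorm_W) (sqnorm_ge0 (rowsub J' Y)).
have := sqnorm_ge0 (rowsub J' Y); rewrite /growth.
set a := sqnorm (rowsub J Y); set b := sqnorm (rowsub J' Y); set c := sqnorm (W *m _).
set g := 4 * _ * _; set w := sqnorm W => b0 gb h1 -> h2.
rewrite mulrDl mul1r mulrDr; lra.
Qed.

(** In the same order of rows, the complement maps [(x1, x2)] to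
    [(0, x2 - W x1)]. *)
Lemma interp_compl_opnorm : sqr_opnorm_le growth (1%:M - interp_proj).
Proof.
move=> q Y; rewrite mulmxBl mul1mx /interp_proj -mulmxA mul_rowsub_mx mul1mx.
pose g : R := 4 * l%:R * (n%:R - l%:R).
have g0 : 0 <= g := le_trans (sqnorm_ge0 W) sqnorm_W.
have e1 : rowsub J (Y - interp_factor *m rowsub J Y) = 0.
  by rewrite linearB /= -mul_rowsub_mx factor_top mul1mx subrr.
have e2 : rowsub J' (Y - interp_factor *m rowsub J Y) = rowsub J' Y - W *m rowsub J Y.
  by rewrite linearB /= -mul_rowsub_mx factor_bottom.
have z0 : sqnorm (0 : 'M[R]_(l, q)) = 0 by rewrite /sqnorm mul0mx mxtrace0.
have [gz|gn0] := eqVneq g 0.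
  have W0 : W = 0.
    apply: sqnorm_eq0; apply/eqP; rewrite eq_le sqnorm_ge0 andbT.
    by apply: le_trans sqnorm_W _; rewrite -/g gz.
  rewrite sqnorm_split e1 e2 z0 W0 mul0mx subr0 add0r (sqnorm_split Y) /growth -/g gz.
  by rewrite addr0 mul1r lerDr sqnorm_ge0.
have gpos : 0 < g by rewrite lt_def gn0.
rewrite sqnorm_split e1 e2 z0 add0r (sqnorm_split Y).
(* With parameter [g], both terms of Young's inequality get the factor [1 + g]. *)
rewrite -[X in sqnorm X]opprB sqnormN; apply: le_trans (sqnormB_young _ _ gpos) _.
have h1 := ler_wpM2r (sqnorm_ge0 (rowsub J Y)) sqnorm_W.
have h2 := le_trans (sqnorm_mulmx W (rowsub J Y)) h1.
rewrite mulrDr -/g lerD2r; apply: le_trans (ler_wpM2l _ h2) _.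
  by rewrite addr_ge0 ?invr_ge0.
by rewrite -/g mulrA mulrDl mul1r mulVf// addrC.
Qed.

(** Interpolation is exact on the columns of [Q]. *)
Lemma interp_compl_Q : (1%:M - interp_proj) *m Q = 0.
Proof.
rewrite mulmxBl mul1mx /interp_proj -mulmxA mul_rowsub_mx mul1mx.
by rewrite /interp_factor -mulmxA mulVmx// mulmx1 subrr.
Qed.

End InterpolatoryFactor.

(** * Error of the decomposition *)

(** The integral of a nonnegative function is a supremum over the simple functions
    below it, which makes it monotone without any measurability. *)
Lemma ge0_le_integral_nonmeasurable d (T : measurableType d) (R : realType)
    (mu : {measure set T -> \bar R}) (f g : T -> \bar R) :
  (forall t, 0 <= f t)%E -> (forall t, f t <= g t)%E ->
  (\int[mu]_t f t <= \int[mu]_t g t)%E.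
Proof.
move=> f0 fg; have g0 t : (0 <= g t)%E := le_trans (f0 t) (fg t).
rewrite !ge0_integralTE//; apply: ereal_sup_le => _ [h hf <-].
by exists h => // t; exact: le_trans (hf t) (fg t).
Qed.

Section ErrorBound.
Context {R : realType} (N n l : nat) (j0 : 'I_N).
Hypothesis l_ltn : (l < n)%N.
Variables (M : tensor R N n).
Variable qr : 'I_N -> 'M[R]_(n, l) -> 'M[R]_(n, l).
Hypothesis qrP : forall j, QR_rule (qr j).
Variable rrqr : 'I_N -> 'M[R]_(l, n) -> 'S_n.
Hypothesis rrqrP : forall j, RRQR_rule 2 (ltnW l_ltn) (rrqr j).
Variables (Omega : 'I_N -> 'M[R]_(n ^ N.-1, l)) (X : 'I_N -> 'M[R]_(l, n ^ N.-1)).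

Let le_ln := ltnW l_ltn.
Let Q j := rid_Q qr M Omega j.
Let s j := rrqr j (Q j)^T.
Let Pi j := interp_proj le_ln (Q j) (s j).

Lemma rid_tucker : rid le_ln qr rrqr M Omega = tucker M Pi.
Proof. by rewrite /rid subtensor_tucker tucker_comp. Qed.

Lemma row_free_orthonormal (B : 'M[R]_(n, l)) : orthonormal_cols B -> row_free B^T.
Proof. by move=> BB; apply/row_freeP; exists B. Qed.

Lemma rid_growth_sqr : rid_growth R n l ^+ 2 = 1 + 4 * l%:R * (n%:R - l%:R).
Proof.
by rewrite sqr_sqrtr// addr_ge0// !mulr_ge0// subr_ge0 ler_nat.
Qed.

(** The comparison matrix [X] is arbitrary: the interpolatory projector
    reproduces the columns of [Q], hence those of the sketch. *)
Lemma rid_error_le :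
  frobenius (M - rid le_ln qr rrqr M Omega) <=
  \sum_(j < N) rid_growth R n l ^+ j.+1 *
    Num.sqrt (sqnorm (unfold j M - unfold j M *m Omega j *m X j)).
Proof.
have g0 : 0 <= rid_growth R n l by exact: sqrtr_ge0.
have strong j : exists Z R11 R12, strong_RRQR 2 le_ln (Q j)^T (s j) Z R11 R12.
  have [+ _] := rrqrP j; apply; apply: row_free_orthonormal.
  have [h _] := qrP j; have [S [_ oQ _]] := h (unfold j M *m Omega j); exact: oQ.
have bPi j : sqr_opnorm_le (rid_growth R n l ^+ 2) (Pi j).
  have [Z [R11 [R12 h]]] := strong j; rewrite rid_growth_sqr; exact: interp_proj_opnorm h.
rewrite rid_tucker tucker_telescope.
apply: le_trans (frobenius_sum j0 _ _) _; apply: ler_sum => j _.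
rewrite (frobenius_unfold j0) -[X in X * _]ger0_norm ?exprn_ge0// -sqrtr_sqr.
rewrite -sqrtrM ?sqr_ge0//; apply: ler_wsqrtr.
pose r := [seq k : 'I_N <- enum 'I_N | (k < j)%N].
rewrite (@eq_tucker _ _ _ _ _ _ (fun k => if k \in r then Pi k else 1%:M)); last first.
  by move=> k; rewrite mem_filter mem_enum andbT.
have szr : size r = j.
  rewrite /r -(size_map val) -(filter_map val (fun k => k < j)%N) val_enum_ord.
  by rewrite (filter_iota_ltn 0 (ltnW (ltn_ord j))) size_iota.
apply: le_trans (sqnorm_tucker_le j0 _ _ bPi _) _.
- exact: sqr_ge0.
- by rewrite filter_uniq// enum_uniq.
have [Z [R11 [R12 h]]] := strong j.
have cQ := interp_compl_Q h.
have -> : sqnorm (unfold j0 (mode_prod j (1%:M - Pi j) M)) =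
  sqnorm ((1%:M - Pi j) *m (unfold j M - unfold j M *m Omega j *m X j)).
  rewrite sqnorm_unfold -(sqnorm_unfold j) unfold_mode_prod mulmxBr !mulmxA.
  have [+ _] := qrP j => /(_ (unfold j M *m Omega j)) [S [YQ _ _]].
  rewrite -[_ *m unfold j M *m Omega j]mulmxA YQ.
  by rewrite [_ *m (_ *m S)]mulmxA cQ !mul0mx subr0.
have -> : (rid_growth R n l ^+ j.+1) ^+ 2 =
  (rid_growth R n l ^+ 2) ^+ j * rid_growth R n l ^+ 2.
  by rewrite -exprM mulnC exprM exprSr.
rewrite szr -[leRHS]mulrA; apply: ler_wpM2l; first by rewrite exprn_ge0// sqr_ge0.
have bc := interp_compl_opnorm h; rewrite rid_growth_sqr; exact: bc.
Qed.

End ErrorBound.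

(** A linear form of Jensen's inequality for the square root, with equality at
    [s ^+ 2 = q]. *)
Lemma sqrt_le_mean (R : rcfType) (q s : R) : 0 <= q -> 0 < s ->
  Num.sqrt q <= (s^-1 * q + s) / 2.
Proof.
move=> q0 s0; set r := Num.sqrt q.
have rq : r ^+ 2 = q by rewrite sqr_sqrtr.
rewrite -rq ler_pdivlMr// -subr_ge0.
have -> : s^-1 * r ^+ 2 + s - r * 2 = (r - s) ^+ 2 / s by field; rewrite gt_eqF.
by rewrite divr_ge0 ?sqr_ge0 ?ltW.
Qed.

Lemma sqrtD_le (R : rcfType) (a b : R) : 0 <= a -> 0 <= b ->
  Num.sqrt (a + b) <= Num.sqrt a + Num.sqrt b.
Proof.
move=> a0 b0; rewrite -[leRHS]ger0_norm ?addr_ge0 ?sqrtr_ge0// -sqrtr_sqr.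
apply: ler_wsqrtr; rewrite sqrrD !sqr_sqrtr//.
by rewrite lerD2r lerDl mulrn_wge0// mulr_ge0 ?sqrtr_ge0.
Qed.

Section Expectation.
Context {R : realType} (N n rt p l : nat).
Hypotheses (N_ge2 : (2 <= N)%N) (rt_ge1 : (1 <= rt)%N) (p_ge2 : (2 <= p)%N).
Hypotheses (l_def : l = (rt + p)%N) (l_ltn : (l < n)%N).
Variable M : tensor R N n.
Variable qr : 'I_N -> 'M[R]_(n, l) -> 'M[R]_(n, l).
Hypothesis qrP : forall j, QR_rule (qr j).
Variable rrqr : 'I_N -> 'M[R]_(l, n) -> 'S_n.
Hypothesis rrqrP : forall j, RRQR_rule 2 (ltnW l_ltn) (rrqr j).
Context d (T : measurableType d) (P : probability T R).
Variable W : 'I_N * 'I_(n ^ N.-1) * 'I_l -> {RV P >-> R}.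
Hypothesis W_gaussian : iid_standard_normal W.

Let gam := rid_growth R n l.
Let kap : R := rt%:R / (p%:R - 1).
Let tau j := \sum_(rt <= i < n) singular_value (unfold j M) i ^+ 2.
Let err t := frobenius (M - rid (ltnW l_ltn) qr rrqr M (random_matrices W t)).

(** With [eps = eta ^ 2], the factor [1 + eta^-1] in front of [eps] in
    [expected_range_error] is harmless, and all corrections are of order [eta]. *)
Lemma rid_error_eta : exists D : 'I_N -> R, (forall j, 0 <= D j) /\
  forall eta : R, 0 < eta <= 1 ->
  (\int[P]_t (err t)%:E <=
   (\sum_(j < N) gam ^+ j.+1 * Num.sqrt ((1 + kap) * tau j + eta * D j))%:E)%E.
Proof.
have n0 : (0 < n)%N by exact: leq_ltn_trans l_ltn.
have N0 : (0 < N)%N by exact: ltnW.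
have l0 : (0 < l)%N by rewrite l_def addn_gt0 rt_ge1.
pose j0 : 'I_N := Ordinal N0.
have m0 : (0 < n ^ N.-1)%N by rewrite expn_gt0 n0.
pose i0 : 'I_N * 'I_(n ^ N.-1) * 'I_l := (j0, Ordinal m0, Ordinal l0).
have gam0 : 0 <= gam by exact: sqrtr_ge0.
have /choice [Pi hPi] : forall j, exists Pj : 'M[R]_(n ^ N.-1),
  [/\ Pj^T = Pj, Pj *m Pj = Pj, \tr Pj <= rt%:R &
      sqnorm (unfold j M - unfold j M *m Pj) <= tau j].
  by move=> j; exact: leading_projector.
have p1 : 0 < p%:R - 1 :> R by rewrite subr_gt0 ltr1n.
have kap0 : 0 <= kap by rewrite divr_ge0// ltW.
have lE : l%:R - rt%:R - 1 = p%:R - 1 :> R by rewrite l_def natrD; ring.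
have rtl : (rt.+1 < l)%N by rewrite l_def -addn1 ltn_add2l.
pose c j := sqnorm (unfold j M - unfold j M *m Pi j).
pose a j := sqnorm (unfold j M).
pose D j := kap * c j + 2 * a j * kap + 1.
have c0 j : 0 <= c j by exact: sqnorm_ge0.
have a0 j : 0 <= a j by exact: sqnorm_ge0.
have D0 j : 0 < D j.
  apply: ltr_wpDl; last exact: ltr01.
  by rewrite addr_ge0// mulr_ge0// mulr_ge0.
exists D; split=> [j|eta /andP[eta0 eta1]]; first exact: ltW.
pose eps := eta ^+ 2.
have eps0 : 0 < eps by rewrite exprn_gt0.
pose K j w : 'M[R]_(_, l) := ridge_pinv_tr j (Pi j) eps w.
pose q j w := sqnorm (unfold j M - unfold j M *m block j w *m (K j w)^T).
have tq j : tempered (q j).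
  have nB : admissible (fun w => block j w : 'M[R]_(n ^ N.-1, l)).
    exact: admissible_block.
  have nG := admissibleM (admissible_cst (Pi j)) nB.
  have nK : admissible (K j) := admissibleM (admissible_resolvent eps0 nG) nG.
  have nM := admissibleM (admissibleM (admissible_cst (unfold j M)) nB) (admissible_tr nK).
  have nR := admissibleD (admissible_cst (unfold j M)) (admissibleN nM).
  exact: tempered_mxtrace (admissibleM nR (admissible_tr nR)).
pose v j := (1 + kap) * tau j + eta * D j.
have v0 j : 0 < v j.
  rewrite ltr_wpDl ?mulr_ge0 ?addr_ge0//.
    by rewrite sumr_ge0// => i _; exact: sqr_ge0.
  by rewrite mulr_gt0.
have Eq j : (\int[P]_t q j (joint W t) <= v j)%R.
  have [sP iP tP cP] := hPi j.
  have := expected_range_error W_gaussian i0 j sP iP eps0 (unfold j M) tP rtl eta0.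
  rewrite lE -/kap -/(c j) -/(a j) => /le_trans; apply.
  have h1 : c j * (1 + kap) <= tau j * (1 + kap) by rewrite ler_wpM2r// addr_ge0.
  have h2 : eta ^+ 2 * (a j * kap) <= eta * (a j * kap).
    by apply: ler_wpM2r; [exact: mulr_ge0|rewrite expr2 ger_pMl].
  rewrite (_ : _ + _ = c j * (1 + kap) + eta * (kap * c j) +
     eta ^+ 2 * (a j * kap) + eta * (a j * kap)); last by rewrite /eps; field; rewrite gt_eqF.
  rewrite /v /D; lra.
pose s j := Num.sqrt (v j).
have s0 j : 0 < s j by rewrite sqrtr_gt0.
pose F w := \sum_(j < N) gam ^+ j.+1 / 2 * ((s j)^-1 * q j w + s j).
have tF1 j : tempered (fun w => (s j)^-1 * q j w + s j).
  by apply: temperedD (tempered_cst _); exact: temperedZ.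
have tF2 (j : 'I_N) : tempered (fun w => gam ^+ j.+1 / 2 * ((s j)^-1 * q j w + s j)).
  exact: temperedZ.
have tF : tempered F by apply: tempered_sum => j _; exact: tF2.
have iF := integrable_tempered W_gaussian i0 tF.
apply: (@le_trans _ _ (\int[P]_t (F (joint W t))%:E)%E).
  apply: ge0_le_integral_nonmeasurable => t; rewrite lee_fin; first exact: sqrtr_ge0.
  apply: le_trans (rid_error_le j0 M qrP rrqrP (random_matrices W t)
    (fun j => (K j (joint W t))^T)) _.
  apply: ler_sum => j _; rewrite -mulrA ler_wpM2l ?exprn_ge0// mulrC.
  exact: sqrt_le_mean (sqnorm_ge0 _) (s0 j).
rewrite -(fineK (integrable_fin_num measurableT iF)) lee_fin -/(Rintegral _ _ _).
rewrite /F (mean_tempered_sum W_gaussian i0 _ tF2); apply: ler_sum => j _.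
rewrite (mean_temperedZ W_gaussian i0 _ (tF1 j)) -mulrA ler_wpM2l ?exprn_ge0//.
rewrite (mean_temperedD W_gaussian i0 (temperedZ _ (tq j)) (tempered_cst (s j))) mean_cst.
rewrite (mean_temperedZ W_gaussian i0 _ (tq j)) -/(v j) -/(s j).
have h : (s j)^-1 * (\int[P]_t q j (joint W t))%R <= s j.
  by rewrite ler_pdivrMl// -expr2 sqr_sqrtr//; exact: ltW.
rewrite -/(s j); lra.
Qed.

Lemma rid_expected_error :
  ('E_P[err] <= (\sum_(j < N) gam ^+ j.+1 * Num.sqrt ((1 + kap) * tau j))%:E)%E.
Proof.
have [D [D0 hD]] := rid_error_eta.
have gam0 : 0 <= gam by exact: sqrtr_ge0.
have p1 : 0 < p%:R - 1 :> R by rewrite subr_gt0 ltr1n.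
have kap0 : 0 <= kap by rewrite divr_ge0// ltW.
have tau0 j : 0 <= tau j by rewrite sumr_ge0// => i _; exact: sqr_ge0.
rewrite unlock; apply/lee_addgt0Pr => e e0.
pose B := 1 + \sum_(j < N) gam ^+ j.+1 * Num.sqrt (D j).
have B0 : 0 < B.
  apply: ltr_wpDr => //; apply: sumr_ge0 => j _.
  by rewrite mulr_ge0 ?exprn_ge0 ?sqrtr_ge0.
(* [theta], the square root of [eta], makes the correction [sqrt (eta * D)] linear. *)
pose theta := Num.min 1 (e / B).
have th0 : 0 < theta by rewrite lt_min ltr01 divr_gt0.
have th1 : theta <= 1 by rewrite ge_min lexx.
have thB : theta * B <= e by rewrite -ler_pdivlMr// ge_min lexx orbT.
have h : 0 < theta ^+ 2 <= 1 by rewrite exprn_gt0//= exprn_ile1// ltW.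
apply: le_trans (hD _ h) _; rewrite -EFinD lee_fin.
apply: le_trans (_ : _ <= \sum_(j < N) gam ^+ j.+1 * Num.sqrt ((1 + kap) * tau j) + theta * B) _;
  last by rewrite lerD2l.
rewrite mulrDr mulr1 mulr_sumr addrCA -big_split /=; apply: (@le_trans _ _ (0 + _)); last first.
  by apply: lerD; [exact: ltW|exact: lexx].
rewrite add0r; apply: ler_sum => j _; rewrite [theta * _]mulrCA -mulrDr.
apply: ler_wpM2l; first exact: exprn_ge0.
apply: le_trans (sqrtD_le _ _) _.
- by rewrite mulr_ge0// addr_ge0.
- by rewrite mulr_ge0// sqr_ge0.
by rewrite lerD2l sqrtrM ?sqr_ge0// sqrtr_sqr ger0_norm ?lexx//; exact: ltW.
Qed.

End Expectation.

Unset Implicit Arguments.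

Theorem theorem1 (R : realType) (N n rt p l : nat)
    (N_ge2 : (2 <= N)%N) (rt_ge1 : (1 <= rt)%N) (p_ge2 : (2 <= p)%N)
    (l_def : l = (rt + p)%N) (l_ltn : (l < n)%N)
    (M : tensor R N n)
    (qr : 'I_N -> 'M[R]_(n, l) -> 'M[R]_(n, l))
    (qrP : forall j, QR_rule (qr j))
    (rrqr : 'I_N -> 'M[R]_(l, n) -> 'S_n)
    (rrqrP : forall j, RRQR_rule 2 (ltnW l_ltn) (rrqr j))
    (d : measure_display) (T : measurableType d) (P : probability T R)
    (W : 'I_N * 'I_(n ^ N.-1) * 'I_l -> {RV P >-> R})
    (W_gaussian : iid_standard_normal W) :
  ('E_P[fun t => frobenius
          (M - rid (ltnW l_ltn) qr rrqr M (random_matrices W t))%R]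
   <= (\sum_(j < N) rid_growth R n l ^+ j.+1 *
         Num.sqrt ((1 + rt%:R / (p%:R - 1)) *
                   \sum_(rt <= i < n) singular_value (unfold j M) i ^+ 2))%R%:E
  )%E.
Proof. exact: rid_expected_error. Qed.
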